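(* Let $k\geq 3$ and let $\mathcal{G}$ be a $k$-uniform supertree of order $n$. Then $\rho(\mathcal{P}(n, k))\leq \rho(\mathcal{G})$, with equality if and only if $\mathcal{G}\cong \mathcal{P}(n, k)$.
   Context: A hypergraph $\mathcal{G}=(V,E)$ has a nonempty finite vertex set and a set of distinct edges, each a subset of $V$ with at least two vertices; $n=|V|$ is the order; it is $k$-uniform if all edges have $k$ vertices. Its adjacency matrix has $(\mathcal{A}_{\mathcal{G}})_{ij}=\sum_{e\in E,\ i,j\in e}\frac{1}{|e|-1}$ for $i\ne j$ and $0$ on the diagonal; $\rho(\mathcal{G})$ is the largest modulus of an eigenvalue of $\mathcal{A}_{\mathcal{G}}$. A supertree is a connected hypergraph with no (Berge) cycle $v_1e_1v_2\cdots v_qe_qv_1$ ($q\ge2$, distinct vertices, distinct edges, $v_i,v_{i+1}\in e_i$ indices mod $q$). A hyperpath of length $q$ is a sequence $v_1e_1v_2e_2\cdots v_qe_qv_{q+1}$ of distinct vertices and distinct edges with $v_i,v_{i+1}\in e_i$, $e_i\cap e_{i+1}=\{v_{i+1}\}$ for $1\le i\le q-1$, and $e_i\cap e_j=\emptyset$ for $|i-j|\ge2$. $\mathcal{P}(n,k)$ denotes the $k$-uniform hypergraph of order $n$ consisting of a hyperpath (its edges being exactly the edges of the hyperpath and its vertices exactly the vertices in them). *)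

(* Defs.v *)
From mathcomp Require Import all_boot all_order all_algebra.
From mathcomp Require Import perm algC.
Set Implicit Arguments. Unset Strict Implicit. Unset Printing Implicit Defensive.
Import Order.TTheory GRing.Theory Num.Theory.
Local Open Scope ring_scope.

(* E is the edge set of a hypergraph on 'I_n: every edge has >= 2 vertices
   (edges are distinct since E is a set). *)
Definition is_hypergraph (n : nat) (E : {set {set 'I_n}}) : Prop :=
  forall e, e \in E -> (2 <= #|e|)%N.

Definition uniform (n k : nat) (E : {set {set 'I_n}}) : Prop :=
  is_hypergraph E /\ forall e, e \in E -> #|e| = k.

Definition hadj (n : nat) (E : {set {set 'I_n}}) : rel 'I_n :=
  fun u v => [exists e in E, (u \in e) && (v \in e)].

Definition hconnected (n : nat) (E : {set {set 'I_n}}) : Prop :=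
  forall u v : 'I_n, connect (hadj E) u v.

(* Berge cycle v_1 e_1 v_2 ... v_q e_q v_1 (0-indexed, indices mod q) *)
Definition has_berge_cycle (n : nat) (E : {set {set 'I_n}}) : Prop :=
  exists (q : nat) (vs : nat -> 'I_n) (es : nat -> {set 'I_n}),
    [/\ (2 <= q)%N,
        forall i j, (i < q)%N -> (j < q)%N -> vs i = vs j -> i = j,
        forall i j, (i < q)%N -> (j < q)%N -> es i = es j -> i = j,
        forall i, (i < q)%N -> es i \in E &
        forall i, (i < q)%N -> (vs i \in es i) && (vs (i.+1 %% q)%N \in es i)].

Definition supertree (n : nat) (E : {set {set 'I_n}}) : Prop :=
  [/\ (0 < n)%N, is_hypergraph E, hconnected E & ~ has_berge_cycle E].

(* The hypergraph E on 'I_n consists of a hyperpath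
   v_1 e_1 v_2 ... v_q e_q v_{q+1} (0-indexed): its edges are exactly the
   edges of the hyperpath, and its vertices exactly the vertices of it. *)
Definition is_hyperpath_hg (n : nat) (E : {set {set 'I_n}}) : Prop :=
  exists (q : nat) (vs : nat -> 'I_n) (es : nat -> {set 'I_n}),
    (forall i j, (i <= q)%N -> (j <= q)%N -> vs i = vs j -> i = j) /\
    (forall i j, (i < q)%N -> (j < q)%N -> es i = es j -> i = j) /\
    (forall i, (i < q)%N -> (vs i \in es i) && (vs i.+1 \in es i)) /\
    (forall i, (i.+1 < q)%N -> es i :&: es i.+1 = [set vs i.+1]) /\
    (forall i j, (j < q)%N -> (i.+2 <= j)%N -> es i :&: es j = set0) /\
    (forall e, e \in E <-> (exists2 i, (i < q)%N & e = es i)) /\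
    (forall v : 'I_n, (exists2 i, (i <= q)%N & v = vs i) \/
                      (exists2 i, (i < q)%N & v \in es i)).

Definition is_Pnk (n k : nat) (E : {set {set 'I_n}}) : Prop :=
  uniform k E /\ is_hyperpath_hg E.

Definition hiso (n : nat) (E1 E2 : {set {set 'I_n}}) : Prop :=
  exists f : {perm 'I_n}, forall e : {set 'I_n}, (e \in E1) = (f @: e \in E2).

Definition adjmx (n : nat) (E : {set {set 'I_n}}) : 'M[algC]_n :=
  \matrix_(i, j) (if i == j then 0
                  else \sum_(e in E | (i \in e) && (j \in e)) ((#|e|.-1)%:R)^-1).

Definition is_spectral_radius (n : nat) (A : 'M[algC]_n) (r : algC) : Prop :=
  (exists2 l, eigenvalue A l & `|l| = r) /\
  (forall l, eigenvalue A l -> `|l| <= r).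

(* Main.v *)
Require Import Defs.
From mathcomp Require Import all_boot all_order all_algebra.
From mathcomp Require Import perm algC spectral.
From mathcomp Require Import zify ring lra.
Set Implicit Arguments. Unset Strict Implicit. Unset Printing Implicit Defensive.
Import Order.TTheory GRing.Theory Num.Theory.
Local Open Scope ring_scope.

(** Let [x] be a Perron vector of a [k]-uniform supertree, [lam = (k-1) rho],
    and let [S e] be the sum of [x] over the edge [e]. The eigenvalue equation
    at [v] says that the ratios [(S e - x v) / x v] of the edges at [v] add up
    to [lam]. Rooting the tree anywhere, the total ratio of a branch is
    determined by the ratios of its sub-branches, and for a pendant hyperpath
    with [j] edges it is [f j = (lam+2) / (a j + 1) - 1], where [a 0 = lam + 1]
    and [a (j+1) = kap - 1 / a j]. The sequence [f] is subadditive as long as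
    the sums stay below [lam], because moving an edge from the shorter to the
    longer of two pendant paths lowers the total ratio; the same holds for
    [1 / a j - 1 / a 0], which governs paths hanging from different vertices of
    one edge. By induction a branch with [m] edges has ratio at least [f m], so
    [f m <= lam] for the whole tree, whereas the hyperpath satisfies
    [f m = lam]; monotonicity in [lam] gives the inequality. Strict
    subadditivity excludes, in the case of equality, vertices of degree three
    and edges with three vertices of degree two, which leaves the hyperpath. *)

(** * The ratio sequence of a pendant hyperpath *)

Section Subadditivity.
Variables (R : realFieldType) (ok : nat -> Prop) (g : nat -> R) (C : R).
Hypothesis g0 : g 0%N = 0.
Hypothesis shift : forall i j, (j < i)%N -> ok i -> ok j.+1 -> g i + g j.+1 <= C ->
  [/\ ok i.+1, ok j, g i.+1 + g j <= g i + g j.+1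
    & g i + g j.+1 < C -> g i.+1 + g j < g i + g j.+1].

(** Units move one at a time from the smaller index to the larger until the pair is [(i + j, 0)]. No
    move increases the sum, so the cap [C] stays respected, and below the cap the first move is
    already strict. *)
Lemma subadditive_of_shift i j : ok i -> ok j -> g i + g j <= C ->
  [/\ ok (i + j)%N, g (i + j)%N <= g i + g j
    & (0 < i)%N -> (0 < j)%N -> g i + g j < C -> g (i + j)%N < g i + g j].
Proof.
wlog le_ji : i j / (j <= i)%N => [hw oki okj le_C|].
  have [/hw|/ltnW/hw] := leqP j i; first exact.
  by rewrite addnC (addrC (g i)) in le_C *; case=> // ? ? h; split=> // *; apply: h.
elim: j i le_ji => [|j IHj] i le_ji oki okj le_C.
  by rewrite addn0 g0 addr0.
have [okSi okj' le_s lt_s] := shift le_ji oki okj le_C.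
have [|okij le_ij _] := IHj i.+1 _ okSi okj' (le_trans le_s le_C); first lia.
rewrite addnS -addSn; split=> // [|_ _ /lt_s]; first exact: le_trans le_s.
exact: le_lt_trans.
Qed.
End Subadditivity.

Section PathSequence.
Variables (R : realFieldType) (k : nat).

(* The subtracted term comes from the [k - 2] vertices of degree one of an inner
   edge. *)
Definition path_const (lam : R) := lam - (k - 2)%:R * (1 + (lam + 1)^-1).

(** Along a hyperpath with eigenvector entries [x], the term of index [j.+1] is
    [(lam + 2) * x v / S - 1], where [S] is the entry sum of edge number [j.+1] and [v] is its far
    end. *)
Fixpoint path_seq (lam : R) (j : nat) : R :=
  if j is i.+1 then path_const lam - (path_seq lam i)^-1 else lam + 1.

(* Beyond its first nonpositive term the sequence has no meaning. *)
Definition path_ok (lam : R) m := forall i, (i <= m)%N -> 0 < path_seq lam i.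

Definition path_ratio (lam : R) j := (lam + 2) / (path_seq lam j + 1) - 1.

(** In an edge with entry sum [S], a vertex [u] carrying a further pendant hyperpath of [j] edges
    has [(lam + 2) * x u / S = 1 + (path_seq lam j)^-1]. The excess compares this with [j = 0], a
    vertex of degree one. *)
Definition path_excess (lam : R) j := (path_seq lam j)^-1 - (lam + 1)^-1.

Variable lam : R.
Hypothesis lam_ge0 : 0 <= lam.
Local Notation a := (path_seq lam).
Local Notation kap := (path_const lam).
Local Notation f := (path_ratio lam).
Local Notation d := (path_excess lam).
Local Notation ok := (path_ok lam).

Lemma path_okW m m' : (m' <= m)%N -> ok m -> ok m'.
Proof. by move=> le_m okm i le_i; apply: okm; apply: leq_trans le_m. Qed.

Lemma path_okS m : ok m -> 0 < a m.+1 -> ok m.+1.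
Proof. by move=> okm am i; rewrite leq_eqVlt => /predU1P[->|/okm]. Qed.

Lemma path_ok0 : ok 0.
Proof. by case=> //= _; rewrite ltr_wpDl. Qed.

(** The first step drops because [kap <= lam]; the decrease propagates since [t -> kap - 1/t] is
    increasing for positive [t]. *)
Lemma path_seq_decr m : ok m -> a m.+1 < a m.
Proof.
have l0 := lam_ge0.
elim: m => [|m IHm] okm.
  have i0 : 0 < (lam + 1)^-1 by rewrite invr_gt0; lra.
  have : 0 <= (k - 2)%:R * (1 + (lam + 1)^-1) by apply: mulr_ge0; rewrite ?ler0n //; lra.
  by rewrite /= /path_const; lra.
have am := okm _ (leqnSn m); have aSm := okm _ (leqnn m.+1).
have := IHm (path_okW (leqnSn m) okm).
by rewrite -ltf_pV2 ?posrE // [a m.+2]/= [a m.+1 in X in _ -> _ < X]/=; lra.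
Qed.

Lemma path_seq_lt m i : ok m -> (i < m)%N -> a m < a i.
Proof.
elim: m => // m IHm okm; rewrite ltnS leq_eqVlt => /predU1P[->|lt_im].
  exact: path_seq_decr (path_okW (leqnSn m) okm).
have okm' := path_okW (leqnSn m) okm.
by apply: lt_trans (path_seq_decr okm') (IHm okm' lt_im).
Qed.

Lemma path_seq_le m i : ok m -> (i <= m)%N -> a m <= a i.
Proof. by move=> okm; rewrite leq_eqVlt => /predU1P[->|/(path_seq_lt okm)/ltW]. Qed.

Lemma path_ratio0 : f 0 = 0.
Proof. by have l0 := lam_ge0; rewrite /path_ratio /=; field; lra. Qed.

Lemma path_excess0 : d 0 = 0.
Proof. by rewrite /path_excess /= subrr. Qed.

Lemma path_ratio_lt m i : ok m -> (i < m)%N -> f i < f m.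
Proof.
have l0 := lam_ge0.
move=> okm lt_im; have lt_a := path_seq_lt okm lt_im.
have am := okm m (leqnn m); have ai := okm i (ltnW lt_im).
by rewrite /path_ratio ltrD2r ltr_pM2l ?ltf_pV2 ?posrE; lra.
Qed.

Lemma path_ratio_le m i : ok m -> (i <= m)%N -> f i <= f m.
Proof. by move=> okm; rewrite leq_eqVlt => /predU1P[->|/(path_ratio_lt okm)/ltW]. Qed.

Lemma path_excess_ge0 m : ok m -> 0 <= d m.
Proof.
have l0 := lam_ge0.
move=> okm; have am := okm m (leqnn m); have := path_seq_le okm (leq0n m).
by rewrite subr_ge0 lef_pV2 ?posrE //=; lra.
Qed.

(* With [z = a i.+1] and [w = a j.+1] the claim is [z + 1/z <= w + 1/w], which
   holds because [1/w <= z <= w]. *)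
Lemma path_excess_shift i j : (j < i)%N -> ok i -> ok j.+1 ->
    d i + d j.+1 <= kap - 2 * (lam + 1)^-1 ->
  [/\ ok i.+1, ok j, d i.+1 + d j <= d i + d j.+1
    & d i + d j.+1 < kap - 2 * (lam + 1)^-1 -> d i.+1 + d j < d i + d j.+1].
Proof.
have l0 := lam_ge0.
move=> lt_ji oki okj; rewrite /path_excess => le_C.
have aj : 0 < a j.+1 by apply: okj.
have ij : 0 < (a j.+1)^-1 by rewrite invr_gt0.
have aSi : (a j.+1)^-1 <= a i.+1 by rewrite /=; move: le_C; rewrite /=; lra.
have aSi0 : 0 < a i.+1 by lra.
have okSi := path_okS oki aSi0.
have lt_a : a i.+1 < a j.+1 by apply: path_seq_lt.
have key : (a j.+1 + (a j.+1)^-1) - (a i.+1 + (a i.+1)^-1)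
     = (a j.+1 - a i.+1) * (a i.+1 - (a j.+1)^-1) / a i.+1.
  by field; rewrite !gt_eqF.
have ei : (a i)^-1 = kap - a i.+1 by rewrite /=; lra.
have ej : (a j)^-1 = kap - a j.+1 by rewrite /=; lra.
split=> //; first exact: path_okW okj.
  have : 0 <= (a j.+1 - a i.+1) * (a i.+1 - (a j.+1)^-1) / a i.+1.
    by apply: divr_ge0; rewrite ?mulr_ge0 //; lra.
  by rewrite -key ei ej; lra.
move=> lt_C.
have : 0 < (a j.+1 - a i.+1) * (a i.+1 - (a j.+1)^-1) / a i.+1.
  apply: divr_gt0; rewrite ?mulr_gt0 //; first lra.
  by move: lt_C; rewrite ei; lra.
by rewrite -key ei ej; lra.
Qed.

(** The gap [lam - (f i + f j)] is [a i * a j - 1] times a positive factor, so the cap on ratios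
    becomes a condition on a product. *)
Lemma path_ratio_sum_le i j : ok i -> ok j ->
  (f i + f j <= lam) = (1 <= a i * a j) /\ (f i + f j < lam) = (1 < a i * a j).
Proof.
have l0 := lam_ge0.
move=> oki okj; have ai := oki i (leqnn i); have aj := okj j (leqnn j).
have e : lam - (f i + f j) = (lam + 2) * (a i * a j - 1) / ((a i + 1) * (a j + 1)).
  by rewrite /path_ratio; field; rewrite !gt_eqF //; lra.
have L : 0 < lam + 2 by lra.
have den : 0 < (a i + 1) * (a j + 1) by rewrite mulr_gt0 //; lra.
split.
  by rewrite -[LHS]subr_ge0 e pmulr_lge0 ?invr_gt0 // pmulr_rge0 // subr_ge0.
by rewrite -[LHS]subr_gt0 e pmulr_lgt0 ?invr_gt0 // pmulr_rgt0 // subr_gt0.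
Qed.

Lemma path_ratio_closing m : ok m ->
  (f m <= lam) = ((lam + 1)^-1 <= a m) /\ (f m < lam) = ((lam + 1)^-1 < a m).
Proof.
have l0 := lam_ge0; have L0 : 0 < lam + 1 by lra.
move=> okm; have [] := path_ratio_sum_le path_ok0 okm.
by rewrite path_ratio0 add0r /= => -> ->; rewrite -!ler_pdivrMl // -!ltr_pdivrMl // !mulr1.
Qed.

Lemma path_ratio_shift i j : (j < i)%N -> ok i -> ok j.+1 -> f i + f j.+1 <= lam ->
  [/\ ok i.+1, ok j, f i.+1 + f j <= f i + f j.+1
    & f i + f j.+1 < lam -> f i.+1 + f j < f i + f j.+1].
Proof.
have l0 := lam_ge0.
move=> lt_ji oki okj; have [-> ->] := path_ratio_sum_le oki okj => le_C.
have okj' : ok j := path_okW (leqnSn j) okj.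
have ai : 0 < a i by apply: oki.
have aj : 0 < a j by apply: okj'.
have aSj : 0 < a j.+1 by apply: okj.
have lt_a : a i < a j by apply: path_seq_lt.
set z := (a i)^-1; set w := (a j)^-1.
have z0 : 0 < z by rewrite invr_gt0.
have w0 : 0 < w by rewrite invr_gt0.
have lt_wz : w < z by rewrite ltf_pV2.
have zai : z * a i = 1 by rewrite mulVf ?gt_eqF.
have eSi : a i.+1 = kap - z by [].
have eSj : a j.+1 = kap - w by [].
have leS : z <= a j.+1 by rewrite -(ler_pM2r ai) zai mulrC.
have aSi0 : 0 < a i.+1 by lra.
have okSi := path_okS oki aSi0.
(* The factor [kap - w - z] is [a j.+1 - z], whose sign comes from [a i * a j.+1 >= 1]; all other
   factors are positive. *)
have key : (f i + f j.+1) - (f i.+1 + f j) =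
  (lam + 2) * (kap + 2) * (z - w) * (kap - w - z)
    / ((1 + z) * (1 + w) * (kap + 1 - w) * (kap + 1 - z)).
  rewrite /path_ratio eSi eSj.
  rewrite -[a i]invrK -[a j]invrK -/z -/w.
  by field; rewrite !gt_eqF //; lra.
have num : 0 < (lam + 2) * (kap + 2) * (z - w) by rewrite !mulr_gt0 //; lra.
have den : 0 < (1 + z) * (1 + w) * (kap + 1 - w) * (kap + 1 - z) by rewrite !mulr_gt0 //; lra.
split=> //.
  by rewrite -subr_ge0 key; apply: divr_ge0 (ltW den); apply: mulr_ge0 (ltW num) _; lra.
move=> lt_C; rewrite -subr_gt0 key; apply: divr_gt0 den; apply: mulr_gt0 num _.
suff : z < a j.+1 by lra.
by rewrite -(ltr_pM2r ai) zai mulrC.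
Qed.

Definition path_ratio_subadd := subadditive_of_shift path_ratio0 path_ratio_shift.
Definition path_excess_subadd := subadditive_of_shift path_excess0 path_excess_shift.
End PathSequence.

Lemma path_seq_mono (R : realFieldType) (k m : nat) (l l' : R) :
    0 <= l -> l < l' -> path_ok k l m ->
  path_seq k l m <= path_seq k l' m.
Proof.
move=> l0 ll'; elim: m => [|m IHm] okm; first by rewrite /=; lra.
have okm' := path_okW (leqnSn m) okm.
have am : 0 < path_seq k l m by apply: okm'.
have le_m := IHm okm'.
have inv_m : (path_seq k l' m)^-1 <= (path_seq k l m)^-1.
  by rewrite lef_pV2 ?posrE //; apply: lt_le_trans le_m.
have inv_l : (l' + 1)^-1 < (l + 1)^-1 by rewrite ltf_pV2 ?posrE; lra.
have : (k - 2)%:R * (1 + (l' + 1)^-1) <= (k - 2)%:R * (1 + (l + 1)^-1).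
  by rewrite ler_wpM2l ?ler0n //; lra.
by rewrite /= /path_const; lra.
Qed.

(** * Branches of an acyclic hypergraph *)

(** A chord would shorten a path of minimal length. The absence of chords later forces the
    hyperedges chosen along the path to be distinct. *)
Lemma connect_shortest (T : finType) (r : rel T) x y : connect r x y ->
  exists p, [/\ path r x p, last x p = y, uniq (x :: p)
    & forall i j, (i.+1 < j)%N -> (j <= size p)%N ->
        ~~ r (nth x (x :: p) i) (nth x (x :: p) j)].
Proof.
pose P s := [exists p : s.-tuple T, path r x p && (last x p == y)].
have Psize p : path r x p -> last x p = y -> P (size p).
  by move=> rp lp; apply/existsP; exists (in_tuple p); rewrite rp lp eqxx.
move=> /connectP[p0 rp0 lp0].
have exP : exists s, P s by exists (size p0); apply: Psize.
case: (ex_minnP exP) => s /existsP[p1 /andP[rp1 /eqP lp1]] min_s.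
have sz1 := size_tuple p1.
case: (shortenP rp1) lp1 => p rp Up sub_p lp.
have szp : (size p <= s)%N by rewrite -sz1; apply: uniq_leq_size sub_p; case/andP: Up.
exists p; split=> // i j lt_ij le_j; apply/negP => rij.
have take_last : last x (take i p) = nth x (x :: p) i.
  case: i lt_ij rij => [|i] lt_ij _ /=; first by rewrite take0.
  by rewrite (take_nth x) ?last_rcons //; lia.
have drop_last : last (nth x (x :: p) j) (drop j p) = y.
  rewrite -lp; case: j lt_ij le_j rij => // j _ le_j _ /=.
  by rewrite -[in RHS](cat_take_drop j p) last_cat (drop_nth x le_j).
have rdrop : path r (nth x (x :: p) j) (drop j p).
  case: j lt_ij le_j rij drop_last => // j _ le_j _ _ /=.
  by move: rp; rewrite -{1}(cat_take_drop j p) cat_path (drop_nth x le_j) /= => /and3P[].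
have rtake : path r x (take i p).
  by move: rp; rewrite -{1}(cat_take_drop i p) cat_path => /andP[].
have := Psize (take i p ++ nth x (x :: p) j :: drop j p).
rewrite cat_path rtake take_last /= rij rdrop last_cat /= drop_last => /(_ isT erefl)/min_s.
rewrite size_cat /= size_take size_drop (leq_trans (ltnW lt_ij) le_j) => le_s.
by move: lt_ij le_j (leq_trans szp le_s); move: (size p) => sz; clear; lia.
Qed.

Section Hypergraph.
Variable n : nat.
Implicit Types (H G : {set {set 'I_n}}) (e : {set 'I_n}).

Definition hdeg H (v : 'I_n) : nat := #|[set e in H | v \in e]|.

Definition ecomp H (v : 'I_n) : {set {set 'I_n}} :=
  [set e in H | [exists u in e, connect (hadj H) v u]].

Lemma hadj_sym H : symmetric (hadj H).
Proof.
by move=> u v; apply/existsP/existsP => -[e /and3P[He ue ve]]; exists e; rewrite He ve ue.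
Qed.

Lemma hadjP H e u v : e \in H -> u \in e -> v \in e -> hadj H u v.
Proof. by move=> He ue ve; apply/existsP; exists e; rewrite He ue ve. Qed.

Lemma hadjS H H' : H \subset H' -> subrel (hadj H) (hadj H').
Proof.
by move=> /subsetP sub u v /existsP[e /and3P[/sub He ue ve]]; apply: (hadjP He).
Qed.

Lemma connect_hadjS H H' : H \subset H' -> subrel (connect (hadj H)) (connect (hadj H')).
Proof. by move=> sub; apply: connect_sub => u v /(hadjS sub)/connect1. Qed.

Lemma acyclicS H H' : H \subset H' -> ~ has_berge_cycle H' -> ~ has_berge_cycle H.
Proof.
move=> /subsetP sub nc [q [vs [es [q2 vinj einj Hes inc]]]]; apply: nc.
by exists q, vs, es; split=> // i /Hes/sub.
Qed.

(** Otherwise a chordless path from [u] to [w] avoiding [e] would close up with [e] to a Berge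
    cycle. *)
Lemma acyclic_bridge H e u w : ~ has_berge_cycle H -> e \in H ->
  u \in e -> w \in e -> connect (hadj (H :\ e)) u w -> u = w.
Proof.
move=> nc He ue we /connect_shortest[p [rp lp Up far]].
apply/eqP/negPn/negP => neq_uw; apply: nc.
pose vs i := nth u (u :: p) i.
(* Index [size p] stands for the closing edge [e]. Below it the default never occurs, since
   consecutive path vertices share an edge of [H :\ e]. *)
pose es i := if (i < size p)%N then
    odflt e [pick g in H :\ e | (vs i \in g) && (vs i.+1 \in g)] else e.
have p0 : (0 < size p)%N by case: (p) lp neq_uw => //= ->; rewrite eqxx.
have esP i : (i < size p)%N -> [&& es i \in H :\ e, vs i \in es i & vs i.+1 \in es i].
  move=> lt_i; rewrite /es lt_i; case: pickP => [g /and3P[-> -> ->] //|].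
  have /existsP[g hg] := pathP u rp i lt_i.
  by move/(_ g)/negP; case; exact: hg.
(* An edge used at both [i] and [j] would contain [vs i] and [vs j.+1], a chord of the path. *)
have es_far i j : (i < j)%N -> (j < size p)%N -> es i <> es j.
  move=> lt_ij lt_j eq_es.
  have /and3P[hi vi _] := esP i (ltn_trans lt_ij lt_j).
  have /and3P[_ _ vj] := esP j lt_j.
  have /negP := far i j.+1 lt_ij lt_j; apply.
  by apply: (hadjP hi vi); rewrite eq_es.
have es_e i : (i < size p)%N -> es i <> e.
  by move=> /esP/and3P[]; rewrite !inE => /andP[/eqP].
have es_last : es (size p) = e by rewrite /es ltnn.
have es_inj i j : (i < j)%N -> (j < (size p).+1)%N -> es i <> es j.
  rewrite ltnS => lt_ij; rewrite leq_eqVlt => /predU1P[ej|]; last exact: es_far.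
  by rewrite ej es_last; apply: es_e; rewrite -ej.
exists (size p).+1, vs, es; split=> //.
- move=> i j lt_i lt_j eq_v; apply/eqP.
  by rewrite -(nth_uniq u _ _ Up) //; apply/eqP.
- by move=> i j lt_i lt_j eq_e; case: (ltngtP i j) => // /es_inj []; rewrite ?eq_e.
- move=> i; rewrite ltnS leq_eqVlt => /predU1P[->|/esP]; first by rewrite es_last.
  by rewrite !inE => /andP[/andP[]].
- move=> i; rewrite ltnS leq_eqVlt => /predU1P[->|lt_i]; last first.
    by rewrite modn_small ?ltnS //; case/and3P: (esP i lt_i) => _ -> ->.
  by rewrite es_last modnn /vs /= (nth_last u (u :: p)) /= lp we ue.
Qed.

(** Whenever the path runs through [e], the starting point is reset to the vertex just reached, so
    only the stretch after the last use of [e] remains. *)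
Lemma connect_delete_edge H e v w : e \in H -> v \in e -> connect (hadj H) v w ->
  exists2 u, u \in e & connect (hadj (H :\ e)) u w.
Proof.
move=> He ve /connectP[p + ->]; elim/last_ind: p => [|p y IHp].
  by move=> _; exists v.
rewrite rcons_path last_rcons => /andP[/IHp[u ue cu] /existsP[g /and3P[Hg lg yg]]].
have [eq_ge|neq_ge] := eqVneq g e; first by exists y; rewrite // -eq_ge.
exists u => //; apply: connect_trans cu (connect1 _).
by apply: (hadjP _ lg yg); rewrite !inE neq_ge.
Qed.

Lemma card_ecomp_delete H e v : e \in H -> v \in e ->
  (#|ecomp H v| <= #|ecomp (H :\ e) v| +
     (\sum_(u in e :\ v) #|ecomp (H :\ e) u|).+1)%N.
Proof.
move=> He ve.
have sub : ecomp H v \subset e |: \bigcup_(u in e) ecomp (H :\ e) u.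
  apply/subsetP => g; rewrite inE => /andP[Hg /existsP[y /andP[yg /(connect_delete_edge He ve)]]].
  case=> u ue cuy; have [->|neq_ge] := eqVneq g e; first by rewrite setU11.
  apply/setU1P; right; apply/bigcupP; exists u => //.
  by rewrite !inE neq_ge Hg; apply/existsP; exists y; rewrite yg.
apply: leq_trans (subset_leq_card sub) _; rewrite cardsU1.
have le_cup : (#|\bigcup_(u in e) ecomp (H :\ e) u| <= \sum_(u in e) #|ecomp (H :\ e) u|)%N.
  elim/big_rec2: _ => [|u s U _ IH]; first by rewrite cards0.
  by rewrite cardsU; apply: leq_trans (leq_subr _ _) _; rewrite leq_add2l.
rewrite addnS -add1n leq_add ?leq_b1 //.
by apply: leq_trans le_cup _; rewrite (big_setD1 v).
Qed.

Lemma hdeg_delete H e v : e \in H -> v \in e -> hdeg H v = (hdeg (H :\ e) v).+1.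
Proof.
move=> He ve; rewrite /hdeg (cardsD1 e) !inE He ve add1n; congr S.
by apply: eq_card => g; rewrite !inE andbA.
Qed.

Lemma hdeg_gt0 H v : (0 < hdeg H v)%N -> exists2 e, e \in H & v \in e.
Proof. by rewrite card_gt0 => /set0Pn[e]; rewrite inE => /andP[]; exists e. Qed.

Lemma ecomp_gt0 H v : (0 < hdeg H v)%N -> (0 < #|ecomp H v|)%N.
Proof.
move=> /hdeg_gt0[e He ve]; apply/card_gt0P; exists e; rewrite inE He.
by apply/existsP; exists v; rewrite ve connect0.
Qed.

Lemma ecomp_isolated H v : hdeg H v = 0%N -> #|ecomp H v| = 0%N.
Proof.
move=> /eqP; rewrite cards_eq0 => /eqP H0; apply/eqP; rewrite cards_eq0; apply/eqP/setP => g.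
rewrite [RHS]inE inE; apply/negP => /andP[Hg /existsP[y /andP[yg /connectP[p]]]].
have noadj e : e \in H -> v \notin e.
  by move=> He; apply/negP => ve; have := in_set0 e; rewrite -H0 inE He ve.
case: p => [|z p] /=; first by move=> _ ey; rewrite ey (negbTE (noadj _ Hg)) in yg.
by case/andP => /existsP[e /and3P[He ve _]]; rewrite (negbTE (noadj _ He)) in ve.
Qed.

Lemma ecomp_connected H v : is_hypergraph H -> hconnected H -> ecomp H v = H.
Proof.
move=> hyp conn; apply/setP => e; rewrite inE andb_idr // => /hyp.
case: (set_0Vmem e) => [->|[u ue _]]; first by rewrite cards0.
by apply/existsP; exists u; rewrite ue conn.
Qed.

End Hypergraph.

(** * Lower bound for the ratio of a branch *)

Section Bound.
Variables (R : realFieldType) (k : nat) (lam : R).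
Hypotheses (k_gt1 : (1 < k)%N) (lam_ge0 : 0 <= lam).
Local Notation a := (path_seq k lam).
Local Notation f := (path_ratio k lam).
Local Notation d := (path_excess k lam).
Local Notation ok := (path_ok k lam).
(** The values [(lam + 2) * x u / S] over an edge add up to [lam + 2], and a vertex of degree one
    has value [1 + (lam + 1)^-1]. Subtracting [k] such values leaves this amount for the
    excesses. *)
Local Notation bound := (path_const k lam - 2 * (lam + 1)^-1).

Lemma path_excess_sum (I : eqType) (r : seq I) (m : I -> nat) :
    (forall i, i \in r -> ok (m i)) -> \sum_(i <- r) d (m i) <= bound ->
  ok (\sum_(i <- r) m i)%N /\ d (\sum_(i <- r) m i)%N <= \sum_(i <- r) d (m i).
Proof.
elim: r => [|i r IHr] okr.
  by rewrite !big_nil => _; split; [apply: path_ok0 | rewrite path_excess0].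
have okr' j : j \in r -> ok (m j) by move=> rj; apply: okr; rewrite inE rj orbT.
have oki : ok (m i) by apply: okr; rewrite mem_head.
have di := path_excess_ge0 lam_ge0 oki.
rewrite !big_cons => le_b.
have [|okS leS] := IHr okr'; first lra.
have [|okM leM _] := path_excess_subadd lam_ge0 oki okS; first lra.
by split=> //; lra.
Qed.

(** [u] and [w] are merged first: both indices are positive, so the binary inequality is strict
    there, and the weak one absorbs the rest. *)
Lemma path_excess_sum_lt (I : finType) (U : {set I}) (m : I -> nat) u w :
    (forall i, i \in U -> ok (m i)) -> \sum_(i in U) d (m i) < bound ->
    u \in U -> w \in U -> u != w -> (0 < m u)%N -> (0 < m w)%N ->
  d (\sum_(i in U) m i)%N < \sum_(i in U) d (m i).
Proof.
move=> okU lt_b Uu Uw neq_uw mu mw; move: lt_b.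
have Uw' : w \in U :\ u by rewrite !inE eq_sym neq_uw.
rewrite !(big_setD1 u Uu) /= !(big_setD1 w Uw') /= !addnA (addrA (d (m u))).
rewrite -!big_enum /=; set r := enum _ => lt_b.
have okr i : i \in r -> ok (m i).
  by rewrite mem_enum !inE => /and3P[_ _ /okU].
have dr : 0 <= \sum_(i <- r) d (m i).
  by rewrite big_seq sumr_ge0 // => i /okr; apply: path_excess_ge0.
have oku := okU u Uu; have okw := okU w Uw.
have du := path_excess_ge0 lam_ge0 oku.
have dw := path_excess_ge0 lam_ge0 okw.
have [|okS leS] := path_excess_sum okr; first lra.
have [|okM leM ltM] := path_excess_subadd lam_ge0 oku okw; first lra.
have {ltM} := ltM mu mw; move/(_ ltac:(lra)) => ltM.
have [|_ le_all _] := path_excess_subadd lam_ge0 okM okS; first lra.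
by lra.
Qed.

(** [F u] stands for the total ratio of the other edges at [u]. Its lower bound makes the share
    [x u / S] large for each [u] other than [v]; the shares add up to one, so that of [v] is small
    and its ratio large. Subadditivity of the excess replaces the branches by a single path. *)
Lemma edge_ratio_bound (I : finType) (e : {set I}) (v : I) (x F : I -> R) (m : I -> nat) :
    let S := \sum_(u in e) x u in
    #|e| = k -> v \in e -> (forall u, 0 < x u) ->
    (forall u, u \in e :\ v -> x u * (lam + 1 - F u) = S) ->
    (forall u, u \in e :\ v -> ok (m u) /\ f (m u) <= F u) ->
    (S - x v) / x v <= lam ->
  let M := (\sum_(u in e :\ v) m u)%N in
  [/\ ok M.+1, f M.+1 <= (S - x v) / x v &
    forall u w, u \in e :\ v -> w \in e :\ v -> u != w -> (0 < m u)%N -> (0 < m w)%N ->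
      (S - x v) / x v < lam -> f M.+1 < (S - x v) / x v].
Proof.
move=> S card_e ve x0 eqF mF le_lam M; have l0 := lam_ge0.
have xv := x0 v.
have S0 : 0 < S.
  rewrite /S (big_setD1 v) //= ltr_pwDl ?x0 //.
  by rewrite sumr_ge0 // => u _; apply: ltW.
set b0 := (lam + 1)^-1.
have b0_gt0 : 0 < b0 by rewrite invr_gt0; lra.
have L0 : 0 < lam + 2 by lra.
have okm u : u \in e :\ v -> ok (m u) by case/mF.
set D := \sum_(u in e :\ v) d (m u).
have y_ge u : u \in e :\ v -> 1 + b0 + d (m u) <= (lam + 2) * (x u / S).
  move=> eu; have [oku leF] := mF u eu; have xu := x0 u.
  have am : 0 < a (m u) by apply: oku.
  have Fpos : 0 < lam + 1 - F u by rewrite -(pmulr_rgt0 _ xu) eqF.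
  have -> : x u / S = (lam + 1 - F u)^-1.
    by rewrite -(eqF u eu); field; rewrite !gt_eqF.
  have -> : 1 + b0 + d (m u) = (lam + 2) / (lam + 1 - f (m u)).
    have -> : lam + 1 - f (m u) = (lam + 2) * a (m u) / (a (m u) + 1).
      by rewrite /path_ratio; field; rewrite gt_eqF //; lra.
    by rewrite /path_excess /b0; field; rewrite !gt_eqF //; lra.
  by rewrite ler_pM2l // lef_pV2 ?posrE //; lra.
have sum_y : (lam + 2) * (x v / S) + \sum_(u in e :\ v) (lam + 2) * (x u / S) = lam + 2.
  rewrite -mulr_sumr -mulrDr -mulr_suml -mulrDl.
  have -> : x v + \sum_(u in e :\ v) x u = S by rewrite /S [RHS](big_setD1 v).
  by rewrite divff ?mulr1 ?gt_eqF.
have sum_D : (k - 1)%:R * (1 + b0) + D <= \sum_(u in e :\ v) (lam + 2) * (x u / S).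
  have -> : (k - 1)%:R * (1 + b0) + D = \sum_(u in e :\ v) (1 + b0 + d (m u)).
    rewrite big_split /= sumr_const -[(1 + b0) *+ _]mulr_natl; congr (_%:R * _ + _).
    by have := cardsD1 v e; rewrite ve card_e => ->; rewrite addKn.
  exact: ler_sum.
have kE : (k - 1)%:R = (k - 2)%:R + 1 :> R.
  by rewrite -(natrD _ _ 1); congr (_%:R); move: k_gt1; lia.
have constE : path_const k lam = lam - (k - 2)%:R * (1 + b0) by [].
rewrite kE mulrDl mul1r in sum_D.
set Y := (lam + 2) * (x v / S) in sum_y.
(* A ratio at most [lam] means that the scaled entry [Y] of [v] is at least that of a vertex of
   degree one. This caps [D]. *)
have Y_ge : ((S - x v) / x v <= lam) = (1 + b0 <= Y) /\ ((S - x v) / x v < lam) = (1 + b0 < Y).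
  have e1 : lam - (S - x v) / x v =
      (Y - (1 + b0)) * ((lam + 1) * S / ((lam + 2) * x v)).
    by rewrite /Y /b0; field; rewrite !gt_eqF //; lra.
  have pos : 0 < (lam + 1) * S / ((lam + 2) * x v).
    by rewrite ?(mulr_gt0, invr_gt0) //; lra.
  split.
    by rewrite -[LHS]subr_ge0 e1 pmulr_lge0 // subr_ge0.
  by rewrite -[LHS]subr_gt0 e1 pmulr_lgt0 // subr_gt0.
have [Yle Ylt] := Y_ge; rewrite Yle in le_lam.
have D_le : D <= bound by rewrite constE -/b0; lra.
have okr i : i \in enum (e :\ v) -> ok (m i) by rewrite mem_enum => /okm.
have := path_excess_sum okr; rewrite !big_enum /= -/D -/M => /(_ D_le)[okM leM].
have aM : a M.+1 = path_const k lam - b0 - d M.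
  by rewrite /= /path_excess -/b0; lra.
have Y_a : Y <= a M.+1 + 1 by rewrite aM constE; lra.
have aM0 : 0 < a M.+1 by lra.
have fE : (S - x v) / x v = (lam + 2) / Y - 1.
  by rewrite /Y; field; rewrite !gt_eqF.
have Y0 : 0 < Y by lra.
split; first exact: path_okS.
  by rewrite fE /path_ratio lerD2r ler_pM2l // lef_pV2 ?posrE //; lra.
move=> u w eu ew neq mu mw; rewrite Ylt fE /path_ratio ltrD2r ltr_pM2l // => ltY.
have D_lt : D < bound by rewrite constE -/b0; lra.
have := path_excess_sum_lt okm D_lt eu ew neq mu mw; rewrite -/D -/M => ltD.
by rewrite ltf_pV2 ?posrE //; move: ltD; rewrite aM constE; lra.
Qed.
End Bound.

Section TreeBound.
Variables (R : realFieldType) (k n : nat) (lam : R) (x : 'I_n -> R).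
Hypotheses (k_gt1 : (1 < k)%N) (lam_ge0 : 0 <= lam) (x_gt0 : forall u, 0 < x u).
Implicit Types (H : {set {set 'I_n}}) (e : {set 'I_n}).
Local Notation f := (path_ratio k lam).
Local Notation ok := (path_ok k lam).

Definition edge_ratio e v := (\sum_(u in e) x u - x v) / x v.

Definition vertex_ratio H v := \sum_(e in H | v \in e) edge_ratio e v.

Lemma edge_ratio_ge0 e v : v \in e -> 0 <= edge_ratio e v.
Proof.
move=> ve; apply: divr_ge0; last exact: ltW.
by rewrite (big_setD1 v) //= addrAC subrr add0r sumr_ge0 // => u _; apply: ltW.
Qed.

Lemma edge_ratio_gt0 e v : v \in e -> (1 < #|e|)%N -> 0 < edge_ratio e v.
Proof.
move=> ve; rewrite (cardsD1 v) ve ltnS => /card_gt0P[w ew].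
apply: divr_gt0 => //; rewrite (big_setD1 v) //= addrAC subrr add0r (big_setD1 w) //=.
by rewrite ltr_pwDl // sumr_ge0 // => u _; apply: ltW.
Qed.

Lemma vertex_ratio_ge0 H v : 0 <= vertex_ratio H v.
Proof. by apply: sumr_ge0 => e /andP[_]; apply: edge_ratio_ge0. Qed.

Lemma vertex_ratio_delete H e v : e \in H -> v \in e ->
  vertex_ratio H v = edge_ratio e v + vertex_ratio (H :\ e) v.
Proof.
move=> He ve; rewrite /vertex_ratio (bigD1 e) ?He //=; congr (_ + _).
by apply: eq_bigl => g; rewrite !inE; case: (g == e); rewrite ?andbF ?andbT.
Qed.

Lemma vertex_ratio_notin H e v : v \notin e -> vertex_ratio (H :\ e) v = vertex_ratio H v.
Proof.
move=> ve; apply: eq_bigl => g; rewrite !inE.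
by have [->|] := eqVneq g e; rewrite ?(negbTE ve) ?andbF.
Qed.

Lemma vertex_ratio_gt0 H v : (forall e, e \in H -> #|e| = k) ->
  (0 < hdeg H v)%N -> 0 < vertex_ratio H v.
Proof.
move=> unif /hdeg_gt0[e He ve]; rewrite (vertex_ratio_delete He ve).
by rewrite ltr_wpDr ?vertex_ratio_ge0 // edge_ratio_gt0 ?(unif e).
Qed.

(** Induction on the number of edges. After deletion of an edge [e] at [v], the branches at its
    other vertices bound the ratio of [e], the remaining edges at [v] form a smaller instance, and
    subadditivity of [path_ratio] joins the two. *)
Lemma ratio_bound H v :
    ~ has_berge_cycle H -> (forall e, e \in H -> #|e| = k) ->
    (forall u, u != v -> connect (hadj H) v u -> vertex_ratio H u = lam) ->
    vertex_ratio H v <= lam ->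
  let m := #|ecomp H v| in
  [/\ ok m /\ f m <= vertex_ratio H v,
      (1 < hdeg H v)%N -> vertex_ratio H v < lam -> f m < vertex_ratio H v,
      (2 < hdeg H v)%N -> f m < vertex_ratio H v &
      forall e u w, e \in H -> v \in e -> u \in e :\ v -> w \in e :\ v -> u != w ->
        (1 < hdeg H v)%N -> (1 < hdeg H u)%N -> (1 < hdeg H w)%N ->
        f m < vertex_ratio H v].
Proof.
have [N] := ubnP #|H|; elim: N => // N IHN in H v *.
rewrite ltnS => szH acyc unif eqv le_lam m.
have [deg0|/hdeg_gt0[e0 He0 ve0]] := posnP (hdeg H v).
  rewrite /m deg0 ecomp_isolated // path_ratio0 //; split=> //.
    by split; [apply: path_ok0 | apply: vertex_ratio_ge0].
suff step e : e \in H -> v \in e ->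
  [/\ ok m /\ f m <= vertex_ratio H v,
      (1 < hdeg H v)%N -> vertex_ratio H v < lam -> f m < vertex_ratio H v,
      (2 < hdeg H v)%N -> f m < vertex_ratio H v &
      forall u w, u \in e :\ v -> w \in e :\ v -> u != w ->
        (1 < hdeg H v)%N -> (1 < hdeg H u)%N -> (1 < hdeg H w)%N ->
        f m < vertex_ratio H v].
  have [b1 b2 b3 _] := step e0 He0 ve0; split=> // e u w He ve.
  by have [_ _ _ b4] := step e He ve; apply: b4.
move=> He ve; set H' := H :\ e.
have sub : H' \subset H by apply: subD1set.
have szH' : (#|H'| < N)%N by move: szH; rewrite (cardsD1 e) He.
have acyc' := acyclicS sub acyc.
have unif' g : g \in H' -> #|g| = k by move/(subsetP sub)/unif.
(* By acyclicity no second vertex of [e] is reachable from [u] without [e], so the deletion leaves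
   the edges at [w] intact. *)
have eqe u w : u \in e -> w != u -> connect (hadj H') u w -> vertex_ratio H' w = lam.
  move=> ue neq_wu cuw.
  have we : w \notin e.
    by apply: contraNN neq_wu => we; rewrite (acyclic_bridge acyc He ue we cuw).
  rewrite (vertex_ratio_notin _ we) eqv //; first by apply: contraNneq we => ->.
  exact: connect_trans (connect1 (hadjP He ve ue)) (connect_hadjS sub cuw).
have eqF u : u \in e :\ v -> x u * (lam + 1 - vertex_ratio H' u) = \sum_(u in e) x u.
  rewrite !inE => /andP[neq_uv ue].
  have := eqv u neq_uv (connect1 (hadjP He ve ue)).
  rewrite (vertex_ratio_delete He ue) -/H' => <-.
  by rewrite /edge_ratio; field; rewrite gt_eqF.
have le_u u : u \in e :\ v -> vertex_ratio H' u <= lam.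
  rewrite !inE => /andP[neq_uv ue].
  have := eqv u neq_uv (connect1 (hadjP He ve ue)).
  by rewrite (vertex_ratio_delete He ue) -/H'; have := edge_ratio_ge0 ue; lra.
have Hsplit := vertex_ratio_delete He ve; rewrite -/H' in Hsplit.
have r0 := vertex_ratio_ge0 H' v.
have e0_gt0 : 0 < edge_ratio e v by apply: edge_ratio_gt0; rewrite ?(unif e).
have le_v : vertex_ratio H' v <= lam by rewrite (le_trans _ le_lam) // Hsplit lerDr ltW.
have [[okv fv] fv2 _ _] := IHN H' v szH' acyc' unif' (eqe v ^~ ve) le_v.
have IHu u : u \in e :\ v -> ok #|ecomp H' u| /\ f #|ecomp H' u| <= vertex_ratio H' u.
  move=> eu; have ue : u \in e by move: eu; rewrite inE => /andP[].
  by have [] := IHN H' u szH' acyc' unif' (eqe u ^~ ue) (le_u u eu).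
have le_e : edge_ratio e v <= lam by rewrite (le_trans _ le_lam) // Hsplit lerDl.
set M := (\sum_(u in e :\ v) #|ecomp H' u|)%N.
have [okM fM fM_lt] : [/\ ok M.+1, f M.+1 <= edge_ratio e v &
    forall u w, u \in e :\ v -> w \in e :\ v -> u != w ->
      (0 < #|ecomp H' u|)%N -> (0 < #|ecomp H' w|)%N ->
      edge_ratio e v < lam -> f M.+1 < edge_ratio e v].
  exact: (edge_ratio_bound k_gt1 lam_ge0 (unif e He) ve x_gt0 eqF IHu).
have le_m : (m <= #|ecomp H' v| + M.+1)%N by apply: card_ecomp_delete.
have fvM := lerD fv fM; rewrite [X in _ <= X]addrC -Hsplit in fvM.
have [okS fS fS_lt] := path_ratio_subadd lam_ge0 okv okM (le_trans fvM le_lam).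
have f_m := le_trans (path_ratio_le lam_ge0 okS le_m) fS.
have degH : hdeg H v = (hdeg H' v).+1 by apply: hdeg_delete.
split.
- by split; [apply: path_okW okS | apply: le_trans fvM].
- rewrite degH ltnS => /ecomp_gt0 m0 lt_lam.
  apply: le_lt_trans (path_ratio_le lam_ge0 okS le_m) (lt_le_trans _ fvM).
  by apply: fS_lt => //; apply: le_lt_trans lt_lam.
(* At least two edges remain at [v], and their ratio is strictly below [lam] because that of [e] is
   positive; the second claim applies to [H']. *)
- rewrite degH ltnS => deg3; apply: le_lt_trans f_m _.
  rewrite Hsplit [X in _ < X]addrC ltr_leD // fv2 //; apply: lt_le_trans le_lam.
  by rewrite Hsplit ltrDr.
(* Another edge at [v] has positive ratio, which puts the ratio of [e] strictly below [lam]; two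
   nonempty branches then make its bound strict. *)
- move=> u w eu ew neq_uw; rewrite degH ltnS => degv degu degw.
  have m0 z : z \in e :\ v -> (1 < hdeg H z)%N -> (0 < #|ecomp H' z|)%N.
    by rewrite inE => /andP[_ ze]; rewrite (hdeg_delete He ze) => ?; apply: ecomp_gt0.
  have Fv : 0 < vertex_ratio H' v by apply: vertex_ratio_gt0.
  apply: le_lt_trans f_m _; rewrite Hsplit [X in _ < X]addrC ler_ltD //.
  apply: fM_lt eu ew neq_uw (m0 u eu degu) (m0 w ew degw) _.
  by apply: lt_le_trans le_lam; rewrite Hsplit ltrDl.
Qed.
End TreeBound.

(** * Perron vectors *)

Section Perron.
Local Open Scope sesquilinear_scope.

(* The entrywise modulus [z] of an extremal eigenvector satisfies [z A >= r z];
   expanding [z A z^T <= r z z^T] in an orthonormal eigenbasis forces equality. *)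
Lemma nonneg_eigenvector n (A : 'M[algC]_n) r :
    (forall i j, 0 <= A i j) -> A^T = A -> is_spectral_radius A r ->
  exists z : 'rV[algC]_n, [/\ z != 0, forall j, 0 <= z 0 j & z *m A = r *: z].
Proof.
move=> A0 Asym [[l /eigenvalueP[x xA x0] nl] max_r].
have r0 : 0 <= r by rewrite -nl.
pose z : 'rV[algC]_n := map_mx Num.norm x.
have z_ge0 j : 0 <= z 0 j by rewrite mxE.
exists z; split=> //.
  by apply: contraNneq x0 => z0; apply/eqP/rowP => j; move/rowP/(_ j): z0; rewrite !mxE => /normr0_eq0.
have zA j : r * z 0 j <= (z *m A) 0 j.
  have := congr1 (fun v : 'rV_n => `|v 0 j|) xA; rewrite !mxE normrM nl => <-.
  apply: le_trans (ler_norm_sum _ _ _) _; apply: ler_sum => i _.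
  by rewrite normrM mxE (ger0_norm (A0 _ _)).
have Ar : A \is a realmx by apply/mxOverP => i j; apply: ger0_real.
have As : A \is symmetricmx by apply/eqP; rewrite expr0 scale1r map_mx_id ?Asym.
have Ah : A \is hermsymmx by apply: realsym_hermsym.
have /orthomx_spectralP A_eq := hermitian_normalmx Ah.
have sp_real := hermitian_spectral_diag_real Ah.
set P := spectralmx A in A_eq; set sp := spectral_diag A in A_eq sp_real.
have Pu : P \is unitarymx by apply: spectral_unitarymx.
have Punit : P \in unitmx by apply: unitarymx_unit.
have sp_le j : sp 0 j <= r.
  have spR : sp 0 j \is Num.real by move/mxOverP: sp_real; apply.
  apply: le_trans (real_ler_norm spR) _; apply: max_r.
  apply/eigenvalueP; exists (row j P).
    by rewrite A_eq !mulmxA -row_mul mulmxV // -row_mul mul1mx row_diag_mx -scalemxAl -rowE.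
  apply/eqP => Pj; have := congr1 (fun M : 'M_n => M j j) (mulmxV Punit).
  have : row j (P *m invmx P) = 0 by rewrite row_mul Pj mul0mx.
  by move/rowP/(_ j); rewrite !mxE => -> /eqP; rewrite eqxx eq_sym oner_eq0.
pose y := z *m invmx P.
have zy : z = y *m P by rewrite mulmxKV.
have zAy : z *m A = y *m diag_mx sp *m P by rewrite A_eq !mulmxA.
have zt : z ^t* = z^T.
  by apply/matrixP => i j; rewrite !mxE; apply: conj_Creal; apply: normr_real.
have dot (u : 'rV_n) : u *m P *m z^T = u *m y ^t*.
  rewrite -zt zy trmx_mul map_mxM -invmx_unitary //=.
  by rewrite mulmxA mulmxK.
have eq1 : \sum_j (z *m A) 0 j * z 0 j = \sum_j sp 0 j * `|y 0 j| ^+ 2.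
  have := congr1 (fun M : 'M_1 => M 0 0) (dot (y *m diag_mx sp)).
  rewrite -zAy !mxE => e; transitivity (\sum_j (z *m A) 0 j * z^T j 0).
    by apply: eq_bigr => j _; rewrite [z^T _ _]mxE.
  rewrite e; apply: eq_bigr => j _.
  by rewrite mul_mx_diag !mxE normCK mulrAC mulrC mulrA.
have eq2 : \sum_j z 0 j * z 0 j = \sum_j `|y 0 j| ^+ 2.
  have := congr1 (fun M : 'M_1 => M 0 0) (dot y).
  rewrite -zy !mxE => e; transitivity (\sum_j z 0 j * z^T j 0).
    by apply: eq_bigr => j _; rewrite [z^T _ _]mxE.
  by rewrite e; apply: eq_bigr => j _; rewrite !mxE normCK.
have le0 : \sum_j (r - sp 0 j) * `|y 0 j| ^+ 2 <= 0.
  under eq_bigr do rewrite mulrBl.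
  rewrite sumrB -eq1 -mulr_sumr -eq2 subr_le0 mulr_sumr.
  by apply: ler_sum => j _; rewrite mulrA ler_wpM2r.
have term_ge0 j : true -> 0 <= (r - sp 0 j) * `|y 0 j| ^+ 2.
  by move=> _; rewrite mulr_ge0 ?subr_ge0 ?exprn_ge0.
have /eqP sum0 : \sum_j (r - sp 0 j) * `|y 0 j| ^+ 2 == 0.
  by rewrite eq_le le0 sumr_ge0.
have yD : y *m diag_mx sp = r *: y.
  apply/rowP => j; rewrite mul_mx_diag [LHS]mxE [RHS]mxE.
  have /eqP := psumr_eq0P term_ge0 sum0 (erefl : (xpredT j)).
  rewrite mulf_eq0 subr_eq0 expf_eq0 normr_eq0 /=.
  by case/orP=> [/eqP->|/eqP->]; rewrite ?mulr0 ?mul0r // mulrC.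
by rewrite zAy yD -scalemxAl -zy.
Qed.
End Perron.

(** * The eigenvalue equation in terms of edge sums *)

Section AdjacencyEigenvector.
Variables (n k : nat) (E : {set {set 'I_n}}).
Hypotheses (k_gt1 : (1 < k)%N) (unif : forall e, e \in E -> #|e| = k).

Lemma adjmx_ge0 i j : 0 <= adjmx E i j.
Proof.
by rewrite mxE; case: eqP => // _; apply: sumr_ge0 => e _; rewrite invr_ge0 ler0n.
Qed.

Lemma adjmx_sym : (adjmx E)^T = adjmx E.
Proof.
apply/matrixP => i j; rewrite !mxE eq_sym; case: eqP => // _.
by apply: eq_bigl => e; rewrite [(_ \in _) && (j \in _)]andbC.
Qed.

Lemma adjmx_row (z : 'rV[algC]_n) u :
  (z *m adjmx E) 0 u * (k.-1)%:R =
    \sum_(e in E | u \in e) (\sum_(w in e) z 0 w - z 0 u).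
Proof.
have k0 : (k.-1)%:R != 0 :> algC by rewrite pnatr_eq0 -lt0n; move: k_gt1; lia.
rewrite mxE mulr_suml.
transitivity (\sum_(e in E | u \in e) \sum_(w in e | w != u) z 0 w); last first.
  apply: eq_bigr => e /andP[_ ue]; rewrite [in RHS](bigD1 u) //=.
  by rewrite addrAC subrr add0r.
rewrite (exchange_big_dep (fun w => w != u)) /=; last by move=> e w _ /andP[].
rewrite [RHS]big_mkcond /=; apply: eq_bigr => w _.
case: eqVneq => [->|neq_wu] /=; first by rewrite mxE eqxx mulr0 mul0r.
rewrite mxE (negbTE neq_wu) -mulrA mulr_suml mulr_sumr.
apply: eq_big => [e|e /andP[/unif-> _]]; first by rewrite andbT andbAC andbA.
by rewrite mulVf // mulr1.
Qed.

(** If the entry at [v] vanishes, so do all terms of the nonnegative sum computing it, hence the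
    entries at the neighbours of [v]. Nonzero entries therefore spread along edges. *)
Lemma connected_eigenvector_gt0 (z : 'rV[algC]_n) r : hconnected E -> z != 0 ->
  (forall j, 0 <= z 0 j) -> z *m adjmx E = r *: z -> forall j, 0 < z 0 j.
Proof.
move=> conn z0 z_ge0 zA.
have [u zu] : exists u, z 0 u != 0.
  apply/existsP; apply: contraNT z0 => /existsPn h.
  by apply/eqP/rowP => j; rewrite mxE; apply/eqP/negPn.
have adj u' v : hadj E u' v -> z 0 u' != 0 -> z 0 v != 0.
  move=> /existsP[e /and3P[He ue ve]] zu'.
  have [<- //|neq] := eqVneq u' v; apply: contraNneq zu' => zv.
  have := congr1 (fun M : 'rV_n => M 0 v) zA; rewrite [RHS]mxE zv mulr0.
  rewrite mxE => /eqP; rewrite psumr_eq0; last first.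
    by move=> i _; rewrite mulr_ge0 ?adjmx_ge0.
  move/allP/(_ u' (mem_index_enum _)); rewrite /= mulf_eq0 => /orP[//|].
  rewrite mxE (negbTE neq) psumr_eq0; last by move=> g _; rewrite invr_ge0 ler0n.
  move/allP/(_ e (mem_index_enum _)); rewrite He ue ve /= invr_eq0 pnatr_eq0 unif //.
  by move: k_gt1; lia.
move=> j; rewrite lt_neqAle z_ge0 andbT eq_sym.
have /connectP[p + ->] := conn u j.
elim/last_ind: p => [//|p w IHp]; rewrite rcons_path last_rcons => /andP[/IHp zp].
by move/adj; apply.
Qed.

(** The ratio estimates live in a totally ordered field, so the entries and the eigenvalue move from
    [algC] to the real algebraic numbers [algR]. *)
Lemma perron_ratio r : hconnected E -> is_spectral_radius (adjmx E) r ->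
  exists (x : 'I_n -> algR) (lam : algR),
    [/\ algRval lam = (k.-1)%:R * r, 0 <= lam, forall u, 0 < x u
      & forall u, vertex_ratio x E u = lam].
Proof.
move=> conn rad; have r0 : 0 <= r by case: rad => -[l _ <-].
have [z [z0 z_ge0 zA]] := nonneg_eigenvector adjmx_ge0 adjmx_sym rad.
have z_gt0 := connected_eigenvector_gt0 conn z0 z_ge0 zA.
have lam0 : 0 <= (k.-1)%:R * r by rewrite mulr_ge0 ?ler0n.
pose x u := in_algR (ger0_real (z_ge0 u)).
pose lam := in_algR (ger0_real lam0).
exists x, lam; split=> //.
move=> u; have xu : x u != 0 by rewrite -val_eqE /= gt_eqF.
rewrite /vertex_ratio /edge_ratio -mulr_suml; apply/eqP.
rewrite -(can_eq (mulfK xu)) divfK //; apply/eqP/val_inj => /=.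
have := adjmx_row z u; rewrite zA mxE => e.
have {}e := etrans (mulrC _ _) e; rewrite mulrA in e; rewrite [RHS]e.
rewrite (rmorph_sum algRval); apply: eq_bigr => g _.
by rewrite rmorphB (rmorph_sum algRval).
Qed.

End AdjacencyEigenvector.

(** * Hyperpaths *)

Local Open Scope nat_scope.

Section Numbering.
Variables (n k : nat).
Hypothesis k_gt1 : 1 < k.
Implicit Types (p : 'I_n -> nat) (X g : {set 'I_n}) (K G P : {set {set 'I_n}}).

(** The vertices of a hyperpath are numbered so that each edge occupies [k] consecutive positions
    and neighbouring edges share one. Matching equal numbers then gives isomorphisms. *)
Definition block p X j : {set 'I_n} :=
  [set x in X | (j * k.-1 <= p x) && (p x <= j.+1 * k.-1)].

(** This is a partial hyperpath with free end [a], where the next edge is attached. The cardinality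
    makes [p] a bijection onto the positions up to [i * k.-1]. *)
Definition numbering p X K i a : Prop :=
  [/\ {in X &, injective p}, a \in X /\ p a = i * k.-1,
      forall x, x \in X -> p x <= i * k.-1, #|X| = (i * k.-1).+1
    & forall e, e \in K <-> exists2 j, j < i & e = block p X j].

Lemma numbering1 p a : p a = 0 -> numbering p [set a] set0 0 a.
Proof.
move=> pa; split.
- by move=> x y /set1P-> /set1P->.
- by rewrite set11.
- by move=> x /set1P->; rewrite pa.
- by rewrite cards1.
- by move=> e; rewrite inE; split=> // -[].
Qed.

Lemma numbering_append p X K i a g b :
    numbering p X K i a -> #|g| = k -> g :&: X = [set a] -> b \in g -> b != a ->
  exists p', numbering p' (X :|: g) (g |: K) i.+1 b.
Proof.
move=> [inj [aX pa] le_p cardX KP] card_g gX bg neq_ba.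
have onlya z : z \in g -> z \in X -> z = a.
  by move=> zg zX; apply/set1P; rewrite -gX inE zg.
have ag : a \in g by have := set11 a; rewrite -gX inE => /andP[].
have bX : b \notin X by apply: contra neq_ba => /(onlya b bg)->.
pose rest := enum (g :\ a :\ b).
have sz_rest : size rest = k - 2.
  have b' : b \in g :\ a by rewrite !inE neq_ba.
  rewrite -cardE; have := cardsD1 a g; have := cardsD1 b (g :\ a).
  by rewrite ag b' card_g => -> ->; rewrite !add1n subn2.
(* [b] gets the last position and becomes the new free end; the other new vertices start right after
   [a], which keeps position [i * k.-1]. *)
pose p' z := if z \in X then p z else
  if z == b then i.+1 * k.-1 else i * k.-1 + (index z rest).+1.
have in_rest z : z \in X :|: g -> z \notin X -> z != b -> z \in rest.
  rewrite mem_enum !inE => /orP[->//|zg] zX ->; rewrite zg andbT /=.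
  by apply: contraNneq zX => ->.
have idx z : z \in X :|: g -> z \notin X -> z != b -> index z rest < k - 2.
  by move=> h1 h2 h3; rewrite -sz_rest index_mem in_rest.
have p'X z : z \in X -> p' z = p z by rewrite /p' => ->.
have p'b : p' b = i.+1 * k.-1 by rewrite /p' (negbTE bX) eqxx.
have p'new z : z \in X :|: g -> z \notin X -> i * k.-1 < p' z <= i.+1 * k.-1.
  move=> zXg zX; rewrite /p' (negbTE zX); case: eqVneq => [_|neq].
    by rewrite leqnn ltn_mul2r -subn1 subn_gt0 k_gt1 ltnSn.
  rewrite mulSn; move: (i * k.-1) (idx z zXg zX neq) => t.
  by move: (index z rest) => r; clear -k_gt1; lia.
have blockX j : j < i -> block p' (X :|: g) j = block p X j.
  move=> lt_j; apply/setP => z; rewrite !inE.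
  have [zX|zX] /= := boolP (z \in X); first by rewrite p'X.
  apply/negP => /and3P[zg _ le_z].
  have zXg : z \in X :|: g by rewrite inE zg orbT.
  have /andP[+ _] := p'new z zXg zX.
  rewrite ltnNge; apply/negP; rewrite negbK (leq_trans le_z) //.
  by rewrite leq_mul2r lt_j orbT.
have blockg : block p' (X :|: g) i = g.
  apply/setP => z; rewrite !inE.
  have [zX|zX] /= := boolP (z \in X).
    rewrite p'X //; apply/andP/idP => [[ge_z _]|zg].
      have -> // : z = a; apply: inj => //; apply/eqP; rewrite pa eqn_leq ge_z le_p //.
    by rewrite (onlya z zg zX) pa leqnn leq_mul2r leqnSn orbT.
  have [zg|//] := boolP (z \in g).
  by have /andP[/ltnW-> ->] := p'new z (subsetP (subsetUr X g) z zg) zX.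
exists p'; split.
- move=> y z yXg zXg; have [yX|yX] := boolP (y \in X); have [zX|zX] := boolP (z \in X).
  + by rewrite !p'X //; apply: inj.
  + move=> e; have /andP[h _] := p'new z zXg zX.
    by rewrite -e p'X // ltnNge le_p in h.
  + move=> e; have /andP[h _] := p'new y yXg yX.
    by rewrite e p'X // ltnNge le_p in h.
  rewrite /p' (negbTE yX) (negbTE zX).
  have [->|yb] := eqVneq y b; have [-> //|zb] := eqVneq z b.
  + rewrite mulSn addnC => /addnI e; move: (idx z zXg zX zb) e.
    by move: (index z rest) => r; clear; lia.
  + rewrite mulSn [_ + i * _]addnC => /addnI e; move: (idx y yXg yX yb) e.
    by move: (index y rest) => r; clear; lia.
  by move=> /addnI[] /(index_inj b (in_rest y yXg yX yb)); apply; apply: in_rest.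
- by rewrite inE bg orbT.
- move=> z zXg; have [zX|zX] := boolP (z \in X).
    by rewrite p'X // (leq_trans (le_p z zX)) // leq_mul2r leqnSn orbT.
  by have /andP[] := p'new z zXg zX.
- have := cardsUI X g; rewrite setIC gX cards1 cardX card_g mulSn.
  by move: #|_| (i * k.-1) => c t; clear -k_gt1; lia.
- move=> e; split.
    case/setU1P => [->|/KP[j lt_j ->]]; first by exists i.
    by exists j; [apply: ltnW | rewrite blockX].
  case=> j; rewrite ltnS leq_eqVlt => /predU1P[->|lt_j] ->.
    by rewrite blockg setU11.
  by rewrite blockX //; apply/setU1P; right; apply/KP; exists j.
Qed.

Lemma numbering_hiso p p' G P i i' a a' :
  numbering p setT G i a -> numbering p' setT P i' a' -> hiso G P.
Proof.
move=> [inj _ le_p cardT GP] [inj' _ le_p' cardT' PP].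
have ei : i = i'.
  move: cardT; rewrite cardT' => -[] /eqP.
  by rewrite eqn_pmul2r; [move/eqP | move: k_gt1; lia].
rewrite -{i'}ei in le_p' cardT' PP.
rewrite cardsT card_ord in cardT.
have toI (r : 'I_n -> nat) : (forall x, x \in [set: 'I_n] -> r x <= i * k.-1) ->
    forall x, r x < n by move=> le_r x; rewrite cardT ltnS le_r ?inE.
pose s x := Ordinal (toI p le_p x); pose s' x := Ordinal (toI p' le_p' x).
have s_inj : injective s by move=> x y /(congr1 val) /= /inj; apply; rewrite inE.
have s'_inj : injective s' by move=> x y /(congr1 val) /= /inj'; apply; rewrite inE.
pose f : {perm 'I_n} := (perm s_inj * (perm s'_inj)^-1)%g.
have fE x : p' (f x) = p x.
  have : perm s'_inj (f x) = perm s_inj x by rewrite /f permM permKV.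
  by rewrite permE [RHS]permE => /(congr1 val).
have blockE j : f @: block p setT j = block p' setT j.
  apply/setP => y; rewrite -[y](permKV f) mem_imset; last exact: perm_inj.
  by rewrite !inE fE.
exists f => e; apply/idP/idP => [/GP[j lt_j ->]|/PP[j lt_j]].
  by apply/PP; exists j; rewrite ?blockE.
by rewrite -blockE => /(imset_inj (@perm_inj _ f))->; apply/GP; exists j.
Qed.

End Numbering.

Local Open Scope ring_scope.

Section Hyperpath.
Variables (n k q : nat) (P : {set {set 'I_n}}) (vs : nat -> 'I_n) (es : nat -> {set 'I_n}).
Hypotheses (k_gt1 : (1 < k)%N) (unif : forall e, e \in P -> #|e| = k).
Hypothesis vs_inj : forall i j, (i <= q)%N -> (j <= q)%N -> vs i = vs j -> i = j.
Hypothesis vs_es : forall i, (i < q)%N -> (vs i \in es i) && (vs i.+1 \in es i).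
Hypothesis es_cap : forall i, (i.+1 < q)%N -> es i :&: es i.+1 = [set vs i.+1].
Hypothesis es_disj : forall i j, (j < q)%N -> (i.+2 <= j)%N -> es i :&: es j = set0.
Hypothesis esP : forall e, e \in P <-> (exists2 i, (i < q)%N & e = es i).
Hypothesis cover : forall v : 'I_n, (exists2 i, (i <= q)%N & v = vs i) \/
                      (exists2 i, (i < q)%N & v \in es i).

Lemma es_in i : (i < q)%N -> es i \in P.
Proof. by move=> lt_i; apply/esP; exists i. Qed.

Lemma es_common i j u : (i < j)%N -> (j < q)%N -> u \in es i -> u \in es j ->
  j = i.+1 /\ u = vs j.
Proof.
move=> lt_ij lt_j ui uj; have uij : u \in es i :&: es j by rewrite inE ui.
move: lt_ij; rewrite leq_eqVlt => /predU1P[ej|lt_ij]; last first.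
  by move: uij; rewrite es_disj ?inE.
by rewrite -ej in lt_j uij *; move: uij; rewrite es_cap // => /set1P->.
Qed.

Lemma vs_edge i j : (i <= q)%N -> (j < q)%N -> vs i \in es j -> i = j \/ i = j.+1.
Proof.
move=> le_i lt_j vij; case: (ltngtP i j) => [lt_ij|lt_ji|->]; [| |by left].
  have /andP[vi _] := vs_es (ltn_trans lt_ij lt_j).
  by have [_ /vs_inj-> //] := es_common lt_ij lt_j vi vij; [left | lia].
right; have [lt_i|] := boolP (i < q)%N.
  by have /andP[vi _] := vs_es lt_i; have [-> _] := es_common lt_ji lt_i vij vi.
(* The last vertex [vs q] has no edge [es q], so the edge before it is used. *)
move=> ge_i; have ei : i = q by lia.
move: lt_ji; rewrite leq_eqVlt => /predU1P[<- //|lt_ji].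
case: i ei vij le_i lt_ji ge_i => [|i] ei vij le_i lt_ji _; first by lia.
have lt_i : (i < q)%N by lia.
have /andP[_ vi] := vs_es lt_i.
have [_ /vs_inj] := es_common (ltnSE lt_ji) lt_i vij vi; lia.
Qed.

Lemma hyperpath_connected : hconnected P.
Proof.
have csym := sym_connect_sym (@hadj_sym n P).
have c0 i : (i <= q)%N -> connect (hadj P) (vs 0) (vs i).
  elim: i => // i IHi lt_i; apply: connect_trans (IHi (ltnW lt_i)) (connect1 _).
  by have /andP[v1 v2] := vs_es lt_i; apply: hadjP (es_in lt_i) v1 v2.
have c u : connect (hadj P) (vs 0) u.
  have [[i le_i ->]|[i lt_i ui]] := cover u; first exact: c0.
  apply: connect_trans (c0 i (ltnW lt_i)) (connect1 _).
  by have /andP[v1 _] := vs_es lt_i; apply: hadjP (es_in lt_i) v1 ui.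
by move=> u v; apply: connect_trans (c v); rewrite csym.
Qed.

Local Open Scope nat_scope.
Lemma hyperpath_numbering : exists p, numbering k p setT P q (vs q).
Proof.
have num i : i <= q -> exists p X K, [/\ numbering k p X K i (vs i),
     forall e, e \in K <-> (exists2 j, j < i & e = es j),
     forall z, z \in X -> z = vs 0 \/ exists2 j, j < i & z \in es j,
     vs 0 \in X & forall j, j < i -> es j \subset X].
  elim: i => [|i IHi] lt_i.
    exists (fun=> 0), [set vs 0], set0; split.
    - exact: numbering1.
    - by move=> e; rewrite inE; split=> // -[].
    - by move=> z /set1P; left.
    - exact: set11.
    - by [].
  have [p [X [K [numX KP XP X0 XE]]]] := IHi (ltnW lt_i).
  have /andP[v1 v2] := vs_es lt_i.
  have eP : es i \in P by apply/esP; exists i.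
  have cap : es i :&: X = [set vs i].
    apply/setP => z; rewrite !inE; apply/andP/eqP => [[ze zX]|->]; last first.
      by split=> //; case: numX => _ [].
    case: (XP z zX) => [ez|[j lt_j zj]].
      rewrite ez in ze *.
      by case: (vs_edge (leq0n q) lt_i ze) => // <-.
    by have [_ ->] := es_common lt_j lt_i zj ze.
  have neq : vs i.+1 != vs i by apply/eqP => /vs_inj; lia.
  have [p' numX'] := numbering_append k_gt1 numX (unif eP) cap v2 neq.
  exists p', (X :|: es i), (es i |: K); split=> //.
  - move=> e; split.
      case/setU1P => [->|/KP[j lt_j ->]]; first by exists i.
      by exists j => //; apply: ltnW.
    case=> j; rewrite ltnS leq_eqVlt => /predU1P[->|lt_j] ->; first exact: setU11.
    by apply/setU1P; right; apply/KP; exists j.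
  - move=> z; rewrite inE => /orP[/XP[|[j lt_j zj]]|ze]; first by left.
      by right; exists j => //; apply: ltnW.
    by right; exists i.
  - by rewrite inE X0.
  - move=> j; rewrite ltnS leq_eqVlt => /predU1P[->|/XE sub]; first exact: subsetUr.
    exact: subset_trans sub (subsetUl _ _).
have [p [X [K [numX KP _ X0 XE]]]] := num q (leqnn q).
have eK : K = P.
  by apply/setP => e; apply/idP/idP => [/KP/esP|/esP/KP].
have eX : X = setT.
  apply/setP => z; rewrite [RHS]inE.
  have in_es i : i < q -> z \in es i -> z \in X by move=> lt_i; apply/subsetP/XE.
  case: (cover z) => [[[|i] le_i ez]|[i lt_i zi]]; last exact: in_es zi.
    by rewrite ez.
  by apply: (in_es i le_i); rewrite ez; case/andP: (vs_es le_i).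
by exists p; rewrite -eX -eK.
Qed.
Local Open Scope ring_scope.

Variables (R : realFieldType) (lam : R) (x : 'I_n -> R).
Hypotheses (lam_ge0 : 0 <= lam) (x_gt0 : forall u, 0 < x u).
Hypothesis x_eig : forall u, vertex_ratio x P u = lam.
Let S i := \sum_(u in es i) x u.

Lemma one_edge i u : (i < q)%N -> u \in es i ->
  (forall j, (j < q)%N -> u \in es j -> j = i) -> S i = (lam + 1) * x u.
Proof.
move=> lt_i ui only_i; have := x_eig u.
rewrite /vertex_ratio (big_pred1 (es i)); last first.
  move=> e /=; apply/andP/eqP => [[/esP[j lt_j ->] uj]|->]; last by rewrite es_in.
  by rewrite (only_i j).
by rewrite /edge_ratio -/(S i) => <-; field; rewrite gt_eqF.
Qed.

Lemma two_edges i : (i.+1 < q)%N -> S i + S i.+1 = (lam + 2) * x (vs i.+1).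
Proof.
move=> lt_i; have /andP[_ vi] := vs_es (ltnW lt_i); have /andP[vi1 _] := vs_es lt_i.
have neq : es i.+1 != es i.
  apply/eqP => ee; have := es_cap lt_i; rewrite ee setIid => ei.
  by have := unif (es_in (ltnW lt_i)); rewrite ei cards1; move: k_gt1; lia.
have := x_eig (vs i.+1).
rewrite (vertex_ratio_delete x (es_in (ltnW lt_i)) vi) (vertex_ratio_delete x _ vi1) //; last first.
  by rewrite !inE neq es_in.
rewrite /vertex_ratio big_pred0 ?addr0; last first.
  move=> e; apply/negP; rewrite !inE -!andbA => /and4P[n1 n2 /esP[j lt_j ej] vj].
  rewrite ej in n1 n2 vj; have [ej'|ej'] := vs_edge (ltnW lt_i) lt_j vj.
    by rewrite ej' eqxx in n1.
  by case: ej' n2 => ->; rewrite eqxx.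
by rewrite /edge_ratio -/(S i) -/(S i.+1) => <-; field; rewrite gt_eqF.
Qed.

Lemma S_gt0 i : (i < q)%N -> 0 < S i.
Proof.
move=> lt_i; have /andP[vi _] := vs_es lt_i.
by rewrite /S (big_setD1 _ vi) /= ltr_pwDl // sumr_ge0 // => u _; apply: ltW.
Qed.

(** The [k - 2] vertices other than the two ends have degree one, which fixes their entries. *)
Lemma edge_sum i : (i < q)%N ->
  S i = x (vs i) + x (vs i.+1) + (k - 2)%:R * (S i / (lam + 1)).
Proof.
move=> lt_i; have l0 := lam_ge0; have /andP[v1 v2] := vs_es lt_i.
have neq : vs i.+1 != vs i by apply/eqP => /vs_inj; lia.
have v2' : vs i.+1 \in es i :\ vs i by rewrite !inE neq.
rewrite {1}/S (big_setD1 _ v1) /= (big_setD1 _ v2') /= addrA; congr (_ + _).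
rewrite (eq_bigr (fun=> S i / (lam + 1))); last first.
  move=> u; rewrite !inE => /and3P[n2 n1 ui].
  rewrite (@one_edge i u) //; first by field; rewrite gt_eqF //; lra.
  move=> j lt_j uj; case: (ltngtP i j) => [lt_ij|lt_ji|//].
    by have [ej eu] := es_common lt_ij lt_j ui uj; rewrite eu ej eqxx in n2.
  by have [_ eu] := es_common lt_ji lt_i uj ui; rewrite eu eqxx in n1.
rewrite sumr_const -[LHS]mulr_natl; congr (_%:R * _).
have := cardsD1 (vs i) (es i); have := cardsD1 (vs i.+1) (es i :\ vs i).
by rewrite v1 v2' (unif (es_in lt_i)) => -> ->; rewrite !add1n subn2.
Qed.

Lemma hyperpath_path_seq : path_seq k lam q = (lam + 1)^-1.
Proof.
have l0 := lam_ge0; have L1 : lam + 1 != 0 by rewrite gt_eqF //; lra.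
have step i : (i < q)%N ->
    (path_seq k lam i)^-1 = (lam + 2) * x (vs i) / S i - 1 ->
    path_seq k lam i.+1 = (lam + 2) * x (vs i.+1) / S i - 1.
  move=> lt_i; rewrite /= => ->; have S0 := S_gt0 lt_i.
  have -> : x (vs i.+1) = S i - x (vs i) - (k - 2)%:R * (S i / (lam + 1)).
    by rewrite {1}(edge_sum lt_i); ring.
  by rewrite /path_const; field; rewrite L1 gt_eqF.
(* At an inner vertex, [S i + S i.+1 = (lam + 2) * x (vs i.+1)] turns the values relative to the two
   edges into [S i.+1 / S i] and [S i / S i.+1], which are reciprocal. *)
have inv i : (i < q)%N -> (path_seq k lam i)^-1 = (lam + 2) * x (vs i) / S i - 1.
  elim: i => [|i IHi] lt_i.
    have /andP[v0 _] := vs_es lt_i; rewrite (one_edge lt_i v0) /=.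
      by field; rewrite L1 gt_eqF.
    by move=> j lt_j /(vs_edge (leq0n q) lt_j)[].
  rewrite (step i (ltnW lt_i) (IHi (ltnW lt_i))) -(two_edges lt_i).
  have := S_gt0 lt_i; have := S_gt0 (ltnW lt_i) => Si SSi.
  by field; rewrite !gt_eqF //; lra.
have [q0|q_gt0] := posnP q.
  have lam0 : lam = 0.
    rewrite -(x_eig (vs 0)) /vertex_ratio big_pred0 // => e.
    by apply/negP => /andP[/esP[i]]; rewrite q0.
  by rewrite q0 /= lam0 add0r invr1.
have lt_q : (q.-1 < q)%N by rewrite prednK.
have /andP[_ vq] := vs_es lt_q; rewrite prednK // in vq.
have := step _ lt_q (inv _ lt_q); rewrite prednK // => ->.
rewrite (one_edge lt_q vq); first by field; rewrite L1 gt_eqF.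
by move=> j lt_j /(vs_edge (leqnn q) lt_j)[]; lia.
Qed.
End Hyperpath.

(** * Supertrees without branching *)

Local Open Scope nat_scope.

Section Structure.
Variables (n k : nat) (G : {set {set 'I_n}}).
Hypothesis k_gt1 : 1 < k.
Hypothesis unif : forall e, e \in G -> #|e| = k.
Hypothesis conn : hconnected G.

Lemma connected_closed (X : {set 'I_n}) v : v \in X ->
  (forall e u w, e \in G -> u \in e -> w \in e -> u \in X -> w \in X) -> X = setT.
Proof.
move=> vX clX; apply/setP => w; rewrite [RHS]inE.
have clos : closed (hadj G) (mem X).
  apply: (intro_closed (sym_connect_sym (@hadj_sym n G))) => u z /existsP[e /and3P[Ge ue ze]].
  exact: clX Ge ue ze.
by have := closed_connect clos (conn v w); rewrite vX.
Qed.

(** The vertex set grows from [v] by edges that meet it, each adding at most [k.-1] vertices;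
    connectedness lets this stop only at the full set. *)
Lemma connected_order_le : 0 < n -> n <= (k.-1 * #|G|).+1.
Proof.
move=> n_gt0; pose v := Ordinal n_gt0.
have grow i : exists (X : {set 'I_n}) (K : {set {set 'I_n}}),
    [/\ v \in X, K \subset G, forall e, e \in K -> e \subset X,
        #|X| <= (k.-1 * #|K|).+1 & X = setT \/ i <= #|X|].
  elim: i => [|i [X [K [vX KG KX leX [eT|le_i]]]]].
  - by exists [set v], set0; rewrite set11 sub0set cards1; split=> // [e|]; [rewrite inE | right].
  - by exists X, K; split=> //; left.
  have [/existsP[e /and3P[Ge /set0Pn[u]]]|] :=
    boolP [exists e in G, (e :&: X != set0) && ~~ (e \subset X)].
    rewrite inE => /andP[ue uX] neX; exists (X :|: e), (e |: K).
    have eK : e \notin K by apply: contra neX; apply: KX.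
    have cap : 0 < #|X :&: e| by apply/card_gt0P; exists u; rewrite inE uX.
    have lt_cap : #|X :&: e| < k.
      rewrite -(unif Ge); apply: proper_card; rewrite properE subsetIr subsetI subxx andbT //.
    have cU := cardsUI X e; rewrite (unif Ge) in cU.
    split.
    - by rewrite inE vX.
    - by rewrite subUset sub1set Ge.
    - move=> g /setU1P[->|/KX sub]; first exact: subsetUr.
      exact: subset_trans sub (subsetUl _ _).
    - rewrite cardsU1 eK mulnDr muln1; move: cU cap leX k_gt1.
      move: #|X :|: e| #|X :&: e| #|X| (k.-1 * #|K|) => a b c d; clear; lia.
    right; move: cU lt_cap le_i; move: #|X :|: e| #|X :&: e| #|X| => a b c; clear; lia.
  move=> /existsPn nocross; exists X, K; split=> //; left.
  apply: connected_closed vX _ => e u w Ge ue we uX.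
  have := nocross e; rewrite Ge /= negb_and !negbK => /orP[/eqP/setP/(_ u)|/subsetP/(_ w we)//].
  by rewrite !inE ue uX.
have [X [K [_ KG _ leX [eT|lt_n]]]] := grow n.+1; last first.
  by have := leq_trans lt_n (max_card (mem X)); rewrite card_ord ltnn.
rewrite eT cardsT card_ord in leX; apply: leq_trans leX _.
by rewrite ltnS leq_mul2l subset_leq_card ?orbT.
Qed.

Lemma hdeg_le1_eq v e e' : hdeg G v <= 1 -> e \in G -> e' \in G -> v \in e -> v \in e' -> e = e'.
Proof.
by move=> /card_le1_eqP h Ge Ge' ve ve'; symmetry; apply: h; rewrite inE ?Ge ?Ge'.
Qed.

Lemma hdeg_le2_eq v e e' g : hdeg G v <= 2 -> e \in G -> e' \in G -> g \in G ->
  v \in e -> v \in e' -> v \in g -> e != e' -> g = e \/ g = e'.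
Proof.
move=> deg2 Ge Ge' Gg ve ve' vg neq.
have [->|neq1] := eqVneq g e; first by left.
have [->|neq2] := eqVneq g e'; first by right.
move: deg2; rewrite /hdeg (cardsD1 e) (cardsD1 e') (cardsD1 g) !inE Ge Ge' Gg ve ve' vg.
by rewrite (eq_sym e') neq neq1 neq2.
Qed.

Hypothesis deg_le2 : forall v, hdeg G v <= 2.
Hypothesis junctions_le2 : forall e u v w, e \in G -> u \in e -> v \in e -> w \in e ->
  u != v -> u != w -> v != w -> 1 < hdeg G u -> 1 < hdeg G v -> 1 < hdeg G w -> False.

Lemma numbering_from_end v0 : hdeg G v0 <= 1 ->
    (forall e u w, e \in G -> v0 \in e -> u \in e -> w \in e -> u != v0 -> w != v0 ->
       u != w -> 1 < hdeg G u -> 1 < hdeg G w -> False) ->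
  exists p i a, numbering k p setT G i a.
Proof.
move=> deg0 end0.
have grow N : exists p i X K a, [/\ numbering k p X K i a, K \subset G,
    forall z e, z \in X -> z != a -> e \in G -> z \in e -> e \in K,
    a = v0 \/ exists2 e, e \in K & a \in e
    & N <= #|X| \/ forall e, e \in G -> a \in e -> e \in K].
  elim: N => [|N [p [i [X [K [a [num KG clos aK [le_N|fin]]]]]]]].
  - exists (fun=> 0), 0, [set v0], set0, v0; split; [exact: numbering1|exact: sub0set| |by left|by left].
    by move=> z e /set1P->; rewrite eqxx.
  - have [/existsP[g /and3P[Gg ag gK]]|] := boolP [exists g in G, (a \in g) && (g \notin K)]; last first.
      move=> /existsPn none; exists p, i, X, K, a; split=> //; right=> e Ge ae.
      by have := none e; rewrite Ge ae /= negbK.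
    have aX : a \in X by case: num => _ [].
    have cap : g :&: X = [set a].
      apply/setP => z; rewrite !inE; apply/andP/eqP => [[zg zX]|-> //].
      by apply/eqP; apply: contraNT gK => neq; apply: clos zX neq Gg zg.
    have [b [bg neq_ba bP]] : exists b, [/\ b \in g, b != a &
        forall z, z \in g -> z != a -> z != b -> hdeg G z <= 1].
      have [/existsP[b /and3P[bg neq degb]]|] :=
          boolP [exists b in g, (b != a) && (1 < hdeg G b)].
        exists b; split=> // z zg za zb; rewrite leqNgt; apply/negP => degz.
        case: aK => [ea|[e eK ae]].
          by rewrite ea in ag neq za; apply: (end0 g z b).
        (* Here [a] has degree two, since it lies in [g] and in an edge of [K]. *)
        apply: (junctions_le2 Gg ag zg bg) => //; try by rewrite eq_sym.
        rewrite ltnNge; apply/negP => dega.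
        have eg := hdeg_le1_eq dega (subsetP KG e eK) Gg ae ag.
        by rewrite -eg eK in gK.
      move=> /existsPn none.
      have : 0 < #|g :\ a| by have := cardsD1 a g; rewrite ag (unif Gg); move: k_gt1; lia.
      case/card_gt0P => b; rewrite !inE => /andP[neq bg]; exists b; split=> // z zg za _.
      by have := none z; rewrite zg za /= -leqNgt.
    have [p' num'] := numbering_append k_gt1 num (unif Gg) cap bg neq_ba.
    exists p', i.+1, (X :|: g), (g |: K), b; split=> //.
    + by rewrite subUset sub1set Gg.
    + move=> z e zXg zb Ge ze; apply/setU1P.
      have [ez|za] := eqVneq z a.
        rewrite ez in ze; case: aK => [ea|[e1 e1K ae1]].
          by left; rewrite -ea in deg0; apply: hdeg_le1_eq deg0 Ge Gg ze ag.
        have neq : g != e1 by apply: contraNneq gK => ->.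
        have [->|->] := hdeg_le2_eq (deg_le2 a) Gg (subsetP KG e1 e1K) Ge ag ae1 ze neq; first by left.
        by right.
      move: zXg; rewrite inE => /orP[zX|zg]; first by right; apply: clos zX za Ge ze.
      by left; apply: hdeg_le1_eq (bP z zg za zb) Ge Gg ze zg.
    + by right; exists g; rewrite ?setU11.
    left; apply: leq_trans (_ : #|X|.+1 <= _) => //; apply: proper_card.
    rewrite properE subsetUl subUset negb_and; apply/orP; right.
    apply: contra neq_ba => /subsetP/(_ b bg) bX.
    by apply/eqP/set1P; rewrite -cap inE bg.
  - by exists p, i, X, K, a; split=> //; right.
have [p [i [X [K [a [num KG clos _ fin]]]]]] := grow n.+1.
case: fin => [lt_n|fin]; first by have := leq_trans lt_n (max_card (mem X)); rewrite card_ord ltnn.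
have inK z e : z \in X -> e \in G -> z \in e -> e \in K.
  move=> zX Ge ze; have [ez|za] := eqVneq z a; last exact: clos zX za Ge ze.
  by apply: fin Ge _; rewrite -ez.
have KX e : e \in K -> e \subset X.
  by case: num => _ _ _ _ KP /KP[j _ ->]; apply/subsetP => z; rewrite inE => /andP[].
have aX : a \in X by case: num => _ [].
have eX : X = setT.
  by apply: connected_closed aX _ => e u w Ge ue we uX; apply: (subsetP (KX e (inK u e uX Ge ue))).
have eK : K = G.
  apply/eqP; rewrite eqEsubset KG; apply/subsetP => e Ge.
  have : 0 < #|e| by rewrite (unif Ge); move: k_gt1; lia.
  by case/card_gt0P => z ze; apply: inK Ge ze; rewrite eX inE.
by exists p, i, a; rewrite -eX -eK.
Qed.

Lemma handshake (B : {set 'I_n}) :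
  \sum_(e in G) #|e :&: B| = \sum_(v in B) hdeg G v.
Proof.
have card_cap (T : finType) (C D : {set T}) : #|C :&: D| = \sum_(v in D) (v \in C : nat).
  rewrite -sum1_card big_mkcond [RHS]big_mkcond; apply: eq_bigr => v _ /=.
  by rewrite inE; case: (v \in C); case: (v \in D).
rewrite (eq_bigr (fun e : {set 'I_n} => \sum_(v in B) (v \in e : nat))); last by move=> e _; apply: card_cap.
rewrite exchange_big; apply: eq_bigr => v _ /=.
rewrite /hdeg setIdE setIC card_cap; by apply: eq_bigr => e _; rewrite inE.
Qed.

(* Every vertex has degree one or two, so there are [k #|G| - n = #|G| - 1]
   vertices of degree two; some edge therefore contains at most one of them. *)
Lemma path_numbering : n = (k.-1 * #|G|).+1 -> exists p i a, numbering k p setT G i a.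
Proof.
move=> nE; have n_gt0 : 0 < n by rewrite nE.
have [G0|G_gt0] := posnP #|G|.
  apply: (@numbering_from_end (Ordinal n_gt0)).
    apply: leq_trans (subset_leq_card _) (_ : #|G| <= 1); rewrite ?G0 //.
    by apply/subsetP => e; rewrite inE => /andP[].
  by move=> e u w Ge; move: G0; rewrite (cardsD1 e) Ge.
have deg_gt0 v : 0 < hdeg G v.
  rewrite lt0n; apply/negP => /eqP deg0.
  have : [set v] = setT.
    apply: connected_closed (set11 v) _ => e u w Ge ue we /set1P euv.
    by rewrite euv in ue; rewrite (hdeg_delete Ge ue) in deg0.
  move/(congr1 (fun A : {set 'I_n} => #|A|)); rewrite cards1 cardsT card_ord nE => -[] /esym/eqP.
  by rewrite muln_eq0 (gtn_eqF G_gt0) orbF -subn1 subn_eq0 leqNgt k_gt1.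
pose J := [set v | 1 < hdeg G v].
have degE v : hdeg G v = 1 + (v \in J).
  by rewrite inE; have := deg_gt0 v; have := deg_le2 v; case: (hdeg G v) => [|[|[|]]].
have cardJ : #|J| + 1 = #|G|.
  have := handshake setT; rewrite (eq_bigr (fun=> k)); last by move=> e Ge; rewrite setIT unif.
  rewrite sum_nat_const (eq_bigr (fun v => 1 + (v \in J))); last by move=> v _; apply: degE.
  rewrite big_split /= sum_nat_const cardsT card_ord muln1.
  have -> : \sum_(v in [set: 'I_n]) (v \in J : nat) = #|J|.
    by rewrite -sum1_card big_mkcond [RHS]big_mkcond; apply: eq_bigr => v _; rewrite inE /=; case: ifP.
  suff arith a b m : m = (k.-1 * b).+1 -> b * k = m + a -> a + 1 = b by apply: arith nE.
  move=> ->; rewrite -{1}(prednK (ltnW k_gt1)) mulnS [_ * k.-1]mulnC.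
  by move: (k.-1 * b) => c; clear; lia.
have [e Ge eJ] : exists2 e, e \in G & #|e :&: J| <= 1.
  apply/exists_inP; rewrite -[X in is_true X]negbK; apply/negP => /exists_inPn all2.
  have := handshake J; rewrite [RHS](eq_bigr (fun=> 2)); last by move=> v vJ; rewrite degE vJ.
  have : \sum_(e in G) 2 <= \sum_(e in G) #|e :&: J|.
    by apply: leq_sum => e Ge; rewrite ltnNge all2.
  move=> + eJ; rewrite eJ !sum_nat_const -cardJ.
  by move: #|J| => a; clear; lia.
have [v0 v0e v0J] : exists2 v0, v0 \in e & v0 \notin J.
  have : 0 < #|e :\: J|.
    have := cardsID J e; rewrite (unif Ge); move: eJ k_gt1.
    by move: #|e :&: J| #|e :\: J| => a b; clear; lia.
  by case/card_gt0P => v; rewrite inE => /andP[vJ ve]; exists v.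
have deg0 : hdeg G v0 <= 1 by move: v0J; rewrite inE -leqNgt.
apply: (numbering_from_end deg0) => g u w Gg v0g ug wg _ _ neq degu degw.
have eg := hdeg_le1_eq deg0 Gg Ge v0g v0e; rewrite eg in ug wg.
move/card_le1_eqP: eJ => /(_ w u); rewrite !inE ug wg degu degw => /(_ isT isT) ewu.
by rewrite ewu eqxx in neq.
Qed.
End Structure.

Local Open Scope ring_scope.

(** * Isomorphism invariance and the main theorem *)

Lemma hiso_sym n (G P : {set {set 'I_n}}) : hiso G P -> hiso P G.
Proof.
case=> f fP; exists (f^-1)%g => e; rewrite fP -imset_comp.
by rewrite (eq_imset (g := id)) ?imset_id // => x /=; rewrite permKV.
Qed.

Lemma hiso_adjmx n (G P : {set {set 'I_n}}) (f : {perm 'I_n}) :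
    (forall e : {set 'I_n}, (e \in G) = (f @: e \in P)) ->
  forall i j, adjmx P (f i) (f j) = adjmx G i j.
Proof.
move=> fP i j; rewrite !mxE (inj_eq perm_inj); case: eqP => // _.
have f_inj := imset_inj (@perm_inj _ f).
rewrite (reindex_inj f_inj) /=; apply: eq_big => [e|e _].
  by rewrite fP !mem_imset //; apply: perm_inj.
by rewrite card_imset //; apply: perm_inj.
Qed.

Lemma hiso_eigenvalue n (G P : {set {set 'I_n}}) l :
  hiso G P -> eigenvalue (adjmx G) l -> eigenvalue (adjmx P) l.
Proof.
case=> f /hiso_adjmx fA /eigenvalueP[v vA v0].
apply/eigenvalueP; exists (\row_j v 0 ((f^-1)%g j)); last first.
  apply: contraNneq v0 => w0; apply/eqP/rowP => j; move/rowP/(_ (f j)): w0.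
  by rewrite !mxE permK.
apply/rowP => j; rewrite -[j](permKV f); set j' := (f^-1)%g j.
move/rowP/(_ j'): vA; rewrite !mxE permK => <-.
rewrite (reindex_inj (@perm_inj _ f)); apply: eq_bigr => i _ /=.
by rewrite mxE permK fA.
Qed.

Lemma hiso_spectral_radius n (G P : {set {set 'I_n}}) rG rP : hiso G P ->
  is_spectral_radius (adjmx P) rP -> is_spectral_radius (adjmx G) rG -> rP = rG.
Proof.
move=> iso [[lP eP <-] maxP] [[lG eG <-] maxG]; apply/eqP; rewrite eq_le.
by rewrite maxP ?maxG //; [apply: hiso_eigenvalue (hiso_sym iso) _ | apply: hiso_eigenvalue eG].
Qed.

Theorem theorem1p3 (n k : nat) (G P : {set {set 'I_n}}) (rG rP : algC) :
  (3 <= k)%N ->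
  uniform k G -> supertree G ->
  is_Pnk k P ->
  is_spectral_radius (adjmx P) rP ->
  is_spectral_radius (adjmx G) rG ->
  rP <= rG /\ (rP = rG <-> hiso G P).
Proof.
move=> k_gt2 [hypG unifG] [n_gt0 _ connG acycG] [[_ unifP]].
case=> q [vs [es [vinj [_ [vse [ecap [edisj [esP cover]]]]]]]] radP radG.
have k_gt1 : (1 < k)%N := ltnW k_gt2.
have k'_gt0 : (0 < k.-1)%N by rewrite -subn1 subn_gt0.
have connP : hconnected P := hyperpath_connected vse esP cover.
have [p numP] := hyperpath_numbering k_gt1 unifP vinj vse ecap edisj esP cover.
have nE : n = (q * k.-1).+1 by case: numP => _ _ _; rewrite cardsT card_ord.
have [xP [lamP [lamPE lamP_ge0 xP_gt0 eigP]]] := perron_ratio k_gt1 unifP connP radP.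
have [xG [lamG [lamGE lamG_ge0 xG_gt0 eigG]]] := perron_ratio k_gt1 unifG connG radG.
have seqP : path_seq k lamP q = (lamP + 1)^-1.
  exact: (hyperpath_path_seq k_gt1 unifP vinj vse ecap edisj esP lamP_ge0 xP_gt0 eigP).
have boundG v := ratio_bound k_gt1 lamG_ge0 xG_gt0 acycG unifG (fun u _ _ => eigG u)
  (eq_ind_r (fun z => z <= lamG) (lexx lamG) (eigG v)).
have ecG v : ecomp G v = G := ecomp_connected v hypG connG.
have [okG fG] : path_ok k lamG #|G| /\ path_ratio k lamG #|G| <= lamG.
  by have [] := boundG (Ordinal n_gt0); rewrite ecG eigG.
(* The hyperpath attains the bound on the order of a connected [k]-uniform hypergraph with a given
   number of edges. *)
have le_q : (q <= #|G|)%N.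
  have := connected_order_le k_gt1 unifG connG n_gt0.
  by rewrite {1}nE ltnS mulnC leq_pmul2l.
have okq := path_okW le_q okG.
have le_lam : lamP <= lamG.
  (* If [lamG < lamP], then [(lamG + 1)^-1 <= path_seq k lamG #|G| <= path_seq k lamG q <= path_seq
     k lamP q = (lamP + 1)^-1], which is absurd. *)
  rewrite leNgt; apply/negP => lt_lam.
  have := path_seq_mono lamG_ge0 lt_lam okq; rewrite seqP.
  have := path_seq_le lamG_ge0 okG le_q.
  have [leE _] := path_ratio_closing lamG_ge0 okG; move: fG; rewrite leE.
  have : (lamP + 1)^-1 < (lamG + 1)^-1 by rewrite ltf_pV2 ?posrE; lra.
  by lra.
split.
  have k0 : 0 < (k.-1)%:R :> algC by rewrite ltr0n.
  by rewrite -(ler_pM2l k0) -lamPE -lamGE.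
split=> [eq_r|iso]; last exact: hiso_spectral_radius iso radP radG.
have elam : lamP = lamG by apply: val_inj; rewrite /= lamPE lamGE eq_r.
rewrite elam in seqP.
(* The ratio at [q] has reached [lamG], and the ratio at [#|G|] does not exceed it; strict
   monotonicity then forces [#|G| = q]. *)
have fq : lamG <= path_ratio k lamG q.
  by rewrite leNgt (path_ratio_closing lamG_ge0 okq).2 seqP ltxx.
have ge_q : (#|G| <= q)%N.
  rewrite leqNgt; apply/negP => /(path_ratio_lt lamG_ge0 okG) lt_f.
  by have := le_lt_trans fq (lt_le_trans lt_f fG); rewrite ltxx.
have eq_q : q = #|G| by apply/eqP; rewrite eqn_leq le_q.
(* The bound is attained at every root, so each strict case of [ratio_bound] is contradictory. *)
have no_lt v : (path_ratio k lamG #|ecomp G v| < vertex_ratio xG G v) -> False.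
  by rewrite ecG eigG -eq_q ltNge fq.
have deg_le2 v : (hdeg G v <= 2)%N.
  rewrite leqNgt; apply/negP => deg3; have [_ _ b3 _] := boundG v.
  exact: no_lt (b3 deg3).
have junc e u v w : e \in G -> u \in e -> v \in e -> w \in e ->
    u != v -> u != w -> v != w ->
    (1 < hdeg G u)%N -> (1 < hdeg G v)%N -> (1 < hdeg G w)%N -> False.
  move=> Ge ue ve we uv uw vw du dv dw; have [_ _ _ b4] := boundG u.
  by apply: (no_lt u); apply: b4 Ge ue _ _ vw du dv dw; rewrite !inE ?ve ?we andbT eq_sym.
have [|pG [i [a numG]]] := path_numbering k_gt1 unifG connG deg_le2 junc.
  by rewrite -eq_q mulnC.
exact: (numbering_hiso k_gt1 numG numP).
Qed.
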